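(* Let $B$ be a finite Blaschke product of degree $N$ with distinct zeros $a_1,\dots,a_N$. For $n=1,\dots,N$ let $B_n(z)=\prod_{j=1}^n\frac{z-a_j}{1-\bar a_jz}$, $C_n=C_{B_n}$, and let $P_n$ be the orthogonal projection of $K^2_B$ onto $K^2_{B_n}$. Let $A$ be a linear operator on $K^2_B$. The following are equivalent: (1) $A\in\mathcal{T}(B)$; (2) for every nonconstant Blaschke product $B_\sigma$ dividing $B$, the operator $A_\sigma=P_{B_\sigma}A|_{K^2_{B_\sigma}}$ is $C_{B_\sigma}$--symmetric; (3) for every $n=1,\dots,N$, the operator $A_n=P_nA|_{K^2_{B_n}}$ is $C_n$--symmetric.
   Context: $B(z)=e^{i\gamma}\prod_{j=1}^N\frac{z-a_j}{1-\bar a_jz}$, $\gamma\in\mathbb{R}$. For an inner function $\theta$: $K^2_\theta=H^2\ominus\theta H^2$, $P_\theta$ the orthogonal projection onto $K^2_\theta$, $C_\theta f(z)=\theta(z)\overline{zf(z)}$ on $|z|=1$; an operator $T$ on $K^2_\theta$ is $C_\theta$--symmetric if $C_\theta TC_\theta=T^*$. An inner $\alpha$ divides $\theta$ if $\bar\alpha\theta$ is inner (then $K^2_\alpha\subset K^2_\theta$). For $\varphi\in L^2$, $A^\theta_\varphi f=P_\theta(\varphi f)$ on $\{f\in K^2_\theta:\varphi f\in L^2\}$; $\mathcal{T}(\theta)$ is the set of bounded such operators (truncated Toeplitz operators). *)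

(* Defs.v *)
(* classical reals.  Functions on the unit circle are modelled
   by their Fourier coefficient sequences (L^2(T) ~ l^2(Z), H^2 ~ l^2(N)). *)
From Stdlib Require Import Reals ZArith List ClassicalEpsilon.
Open Scope R_scope.

Definition Cx : Type := (R * R)%type.
Definition C0 : Cx := (0, 0).
Definition C1 : Cx := (1, 0).
Definition Cadd (x y : Cx) : Cx := (fst x + fst y, snd x + snd y).
Definition Copp (x : Cx) : Cx := (- fst x, - snd x).
Definition Cmul (x y : Cx) : Cx :=
  (fst x * fst y - snd x * snd y, fst x * snd y + snd x * fst y).
Definition Cconj (x : Cx) : Cx := (fst x, - snd x).
Definition Cnorm2 (x : Cx) : R := fst x * fst x + snd x * snd x.
Definition Cexpi (g : R) : Cx := (cos g, sin g).
Fixpoint Cpow (x : Cx) (n : nat) : Cx :=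
  match n with O => C1 | S m => Cmul x (Cpow x m) end.

(* ---------- limits (chosen by Hilbert's epsilon; junk if divergent) ---------- *)
Definition Ccv (s : nat -> Cx) (l : Cx) : Prop :=
  Un_cv (fun N => fst (s N)) (fst l) /\ Un_cv (fun N => snd (s N)) (snd l).
Definition Clim (s : nat -> Cx) : Cx := epsilon (inhabits C0) (fun l : Cx => Ccv s l).
Definition Rlim (s : nat -> R) : R := epsilon (inhabits 0) (fun l => Un_cv s l).

Definition seqZ : Type := Z -> Cx.

Fixpoint psumZ (u : Z -> Cx) (N : nat) : Cx :=
  match N with
  | O => u 0%Z
  | S m => Cadd (psumZ u m) (Cadd (u (Z.of_nat N)) (u (- Z.of_nat N)%Z))
  end.
Fixpoint psumZR (u : Z -> R) (N : nat) : R :=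
  match N with
  | O => u 0%Z
  | S m => psumZR u m + (u (Z.of_nat N) + u (- Z.of_nat N)%Z)
  end.

Definition sumZ (u : Z -> Cx) : Cx := Clim (psumZ u).

Definition sadd (f g : seqZ) : seqZ := fun n => Cadd (f n) (g n).
Definition ssub (f g : seqZ) : seqZ := fun n => Cadd (f n) (Copp (g n)).
Definition sscal (c : Cx) (f : seqZ) : seqZ := fun n => Cmul c (f n).
Definition szero : seqZ := fun _ => C0.
Definition delta0 : seqZ := fun n => if Z.eqb n 0 then C1 else C0.

Definition l2 (f : seqZ) : Prop :=
  exists l, Un_cv (psumZR (fun n => Cnorm2 (f n))) l.
Definition nsq (f : seqZ) : R := Rlim (psumZR (fun n => Cnorm2 (f n))).
Definition ip (f g : seqZ) : Cx := sumZ (fun n => Cmul (f n) (Cconj (g n))).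

Definition H2 (f : seqZ) : Prop := l2 f /\ forall n, (n < 0)%Z -> f n = C0.

(* product of functions = convolution of Fourier coefficients *)
Definition conv (u v : seqZ) : seqZ :=
  fun n => sumZ (fun k => Cmul (u (n - k)%Z) (v k)).

(* Fourier coefficients of the complex conjugate function *)
Definition cstar (f : seqZ) : seqZ := fun n => Cconj (f (- n)%Z).

(* inner function: theta in H^2 (hence H^infty) with |theta|^2 = 1 a.e. *)
Definition is_inner (th : seqZ) : Prop := H2 th /\ conv th (cstar th) = delta0.

Definition divides (al th : seqZ) : Prop :=
  is_inner al /\ is_inner th /\ is_inner (conv (cstar al) th).

Definition K2 (th : seqZ) (f : seqZ) : Prop :=
  H2 f /\ forall h, H2 h -> ip f (conv th h) = C0.

Definition Pth (th : seqZ) (g : seqZ) : seqZ :=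
  epsilon (inhabits szero)
    (fun p => K2 th p /\ forall k, K2 th k -> ip (ssub g p) k = C0).

(* conjugation C_theta f = theta * conj(z f) on the circle;
   conj(z f) has n-th Fourier coefficient conj(f_{-n-1}) *)
Definition Cop (th : seqZ) (f : seqZ) : seqZ :=
  conv th (fun n => Cconj (f (- n - 1)%Z)).

(* T (an operator on K^2_theta) is C_theta-symmetric: C T C = T^*,
   i.e. <C T C f, g> = <f, T g> for all f, g in K^2_theta *)
Definition Csymmetric (th : seqZ) (T : seqZ -> seqZ) : Prop :=
  forall f g, K2 th f -> K2 th g -> ip (Cop th (T (Cop th f))) g = ip f (T g).

Definition compress (sg : seqZ) (A : seqZ -> seqZ) : seqZ -> seqZ :=
  fun f => Pth sg (A f).

Definition lin_op_on (th : seqZ) (A : seqZ -> seqZ) : Prop :=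
  (forall f, K2 th f -> K2 th (A f)) /\
  (forall f g, K2 th f -> K2 th g -> A (sadd f g) = sadd (A f) (A g)) /\
  (forall c f, K2 th f -> A (sscal c f) = sscal c (A f)).

(* A belongs to T(theta): A is the (bounded extension of the) bounded,
   densely defined truncated Toeplitz operator A^theta_phi for some phi in L^2 *)
Definition in_TTO (th : seqZ) (A : seqZ -> seqZ) : Prop :=
  exists phi, l2 phi /\
    (forall f, K2 th f -> forall eps, 0 < eps ->
       exists g, K2 th g /\ l2 (conv phi g) /\ nsq (ssub f g) < eps) /\
    (exists M, forall f, K2 th f -> l2 (conv phi f) ->
       nsq (Pth th (conv phi f)) <= M * nsq f) /\
    (forall f, K2 th f -> l2 (conv phi f) -> A f = Pth th (conv phi f)).

(* Fourier (Taylor) coefficients of (z - a)/(1 - conj(a) z) *)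
Definition bfactor (a : Cx) : seqZ :=
  fun n =>
    match n with
    | Z0 => Copp a
    | Zpos p => Cmul (Cpow (Cconj a) (Pos.to_nat p - 1))
                     (1 - Cnorm2 a, 0)
    | Zneg _ => C0
    end.

Definition blaschke (gamma : R) (zs : list Cx) : seqZ :=
  sscal (Cexpi gamma) (fold_right (fun a acc => conv (bfactor a) acc) delta0 zs).

Definition in_disk (zs : list Cx) : Prop := forall a, In a zs -> Cnorm2 a < 1.

(* Main.v *)
(* A finite Blaschke product has absolutely summable coefficients, and square
   summable sequences form a module over the convolution algebra of summable
   ones; on it, convolution by [a] has adjoint convolution by [cstar a].  In these
   terms an operator with symbol [phi] satisfies
     <phi C f, C g> = <phi g, f>
   because [C f] conj([C g]) = conj([f]) [g] on the circle, which gives (1) => (2).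

   For (3) => (1) a symbol is built one zero at a time.  Let [th = b_a th'] with
   [th'(a) <> 0], let [k] be the reproducing kernel at [a] and suppose that
   [D = A - phi] vanishes as a form on [K_th'].  Every [f] in [K_th] is a multiple
   of [k] plus an element of [K_th'], the coefficient for [C f] being proportional
   to conj(f(a)).  Symmetry then reads [g(a) <D f, k> = f(a) <D g, k>] on [K_th'],
   so [<D f, k> = t f(a)], and adding a multiple of [th'] to [phi] removes this
   term.  Now symmetry makes [D k] a multiple of [k], which a multiple of conj(th')
   removes.  Distinctness of the zeros enters only through [th'(a) <> 0]. *)

From Pilot Require Import Defs.
From Stdlib Require Import Reals ZArith List Lra Lia.
From Stdlib Require Import FunctionalExtensionality ClassicalEpsilon.
From Coquelicot Require Complex.
(* [Reals] also exports a constant [C1]; this puts the one of [Defs] back in front. *)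
Import Pilot.Defs.
Open Scope R_scope.

(** In (1) the symbol is merely square summable, so [phi f] need not lie in L^2 for an arbitrary [f]
    in L^2. The argument survives because every element of the model space of a finite Blaschke
    product has summable coefficients: [phi f] is then in L^2 throughout the space, and [f] instead
    of [phi] can serve as the summable factor in the adjoint formula. Conversely, the symbol
    constructed for (1) comes from constants and finitely many multiples of functions [th'] and
    conj(th'). It is therefore summable, which makes the operator bounded and everywhere defined.

    The corrections are chosen so as not to spoil what is already achieved. Since [th' H^2] is
    orthogonal to [K_th'], adding [th'] leaves the form on [K_th'] unchanged; and conj(th') sends
    [K_th'] to functions orthogonal to H^2, so it is invisible there as well. Symmetry is used as
    ordinary symmetry of the bilinear form [<A f, C g>], in which the compressions disappear, so one
    and the same [A] serves at every stage. *)

Notation Cmod := Coquelicot.Complex.Cmod.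

Declare Scope Cx_scope.
Delimit Scope Cx_scope with Cx.
Notation "x + y" := (Cadd x y) : Cx_scope.
Notation "x * y" := (Cmul x y) : Cx_scope.
Notation "- x" := (Copp x) : Cx_scope.

(** * Complex numbers *)

Definition Csub (x y : Cx) : Cx := Cadd x (Copp y).
Definition Cinv (x : Cx) : Cx := (fst x / Cnorm2 x, - snd x / Cnorm2 x).
Definition Cdiv (x y : Cx) : Cx := Cmul x (Cinv y).
Notation "x - y" := (Csub x y) : Cx_scope.
Notation "x / y" := (Cdiv x y) : Cx_scope.

Lemma Cnorm2_ge0 x : 0 <= Cnorm2 x.
Proof. unfold Cnorm2; nra. Qed.

Lemma Cnorm2_eq0 x : Cnorm2 x = 0 -> x = C0.
Proof.
  destruct x as [a b]; unfold Cnorm2, C0; simpl; intros H.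
  f_equal; nra.
Qed.

Lemma Cx_field : field_theory C0 C1 Cadd Cmul Csub Copp Cdiv Cinv eq.
Proof.
  split.
  - split; intros; unfold Csub, Cadd, Cmul, Copp, C0, C1;
      repeat match goal with x : Cx |- _ => destruct x end; simpl;
      f_equal; ring.
  - intros H; injection H; lra.
  - reflexivity.
  - intros [a b] H.
    assert (Hn : Cnorm2 (a, b) <> 0)
      by (intros E; apply H; apply Cnorm2_eq0; exact E).
    unfold Cinv, Cmul, C1, Cnorm2 in *; simpl in *; f_equal; field; exact Hn.
Qed.

Add Field Cx_field_inst : Cx_field.

Lemma Cx_ext (x y : Cx) : fst x = fst y -> snd x = snd y -> x = y.
Proof. destruct x, y; simpl; congruence. Qed.

Lemma Cconj_add x y : Cconj (x + y)%Cx = (Cconj x + Cconj y)%Cx.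
Proof. apply Cx_ext; simpl; ring. Qed.
Lemma Cconj_mul x y : Cconj (x * y)%Cx = (Cconj x * Cconj y)%Cx.
Proof. apply Cx_ext; simpl; ring. Qed.
Lemma Cconj_opp x : Cconj (- x)%Cx = (- Cconj x)%Cx.
Proof. apply Cx_ext; simpl; ring. Qed.
Lemma Cconj_conj x : Cconj (Cconj x) = x.
Proof. apply Cx_ext; simpl; ring. Qed.
Lemma Cconj_0 : Cconj C0 = C0.
Proof. apply Cx_ext; simpl; ring. Qed.
Lemma Cconj_1 : Cconj C1 = C1.
Proof. apply Cx_ext; simpl; ring. Qed.
Lemma Cconj_neq0 x : x <> C0 -> Cconj x <> C0.
Proof. intros H E; apply H; rewrite <- (Cconj_conj x), E; apply Cconj_0. Qed.
Lemma Cmul_conj x : (x * Cconj x)%Cx = (Cnorm2 x, 0).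
Proof. apply Cx_ext; unfold Cnorm2; simpl; ring. Qed.

Lemma Cmul_neq0 x y : x <> C0 -> y <> C0 -> (x * y)%Cx <> C0.
Proof.
  intros Hx Hy E; apply Hx.
  replace x with ((x * y) / y)%Cx by (field; exact Hy).
  rewrite E; field; exact Hy.
Qed.

Lemma Cmul_reg_r x y z : z <> C0 -> (x * z)%Cx = (y * z)%Cx -> x = y.
Proof.
  intros Hz E.
  replace x with ((x * z) / z)%Cx by (field; exact Hz).
  rewrite E; field; exact Hz.
Qed.

Lemma Cmod_sqr x : Cmod x * Cmod x = Cnorm2 x.
Proof.
  unfold Complex.Cmod; rewrite sqrt_sqrt; [unfold Cnorm2; ring | nra].
Qed.
Lemma Cmod_ge0 x : 0 <= Cmod x.
Proof. apply Complex.Cmod_ge_0. Qed.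
Lemma Cmod_add x y : Cmod (x + y)%Cx <= Cmod x + Cmod y.
Proof. exact (Complex.Cmod_triangle x y). Qed.
Lemma Cmod_mul x y : Cmod (x * y)%Cx = Cmod x * Cmod y.
Proof. exact (Complex.Cmod_mult x y). Qed.
Lemma Cmod_opp x : Cmod (- x)%Cx = Cmod x.
Proof. exact (Complex.Cmod_opp x). Qed.
Lemma Cmod_conj x : Cmod (Cconj x) = Cmod x.
Proof. exact (Complex.Cmod_conj x). Qed.
Lemma Cmod_C0 : Cmod C0 = 0.
Proof. exact Complex.Cmod_0. Qed.
Lemma Cmod_C1 : Cmod C1 = 1.
Proof. exact Complex.Cmod_1. Qed.
Lemma Cmod_fst x : Rabs (fst x) <= Cmod x.
Proof.
  eapply Rle_trans; [apply Rmax_l | apply Complex.Rmax_Cmod].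
Qed.
Lemma Cmod_snd x : Rabs (snd x) <= Cmod x.
Proof.
  eapply Rle_trans; [apply Rmax_r | apply Complex.Rmax_Cmod].
Qed.
Lemma Cmod_le_abs x : Cmod x <= Rabs (fst x) + Rabs (snd x).
Proof.
  pose proof (Cmod_sqr x) as H; pose proof (Cmod_ge0 x).
  pose proof (Rabs_pos (fst x)); pose proof (Rabs_pos (snd x)).
  unfold Cnorm2 in H.
  assert (E1 : fst x * fst x = Rabs (fst x) * Rabs (fst x))
    by exact (Rsqr_abs (fst x)).
  assert (E2 : snd x * snd x = Rabs (snd x) * Rabs (snd x))
    by exact (Rsqr_abs (snd x)).
  nra.
Qed.
Lemma Cmod_sub_sym x y : Cmod (x - y)%Cx = Cmod (y - x)%Cx.
Proof. rewrite <- Cmod_opp; f_equal; ring. Qed.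
Lemma Cmod_mul_le x y : Cmod (x * y)%Cx <= (Cnorm2 x + Cnorm2 y) / 2.
Proof.
  rewrite Cmod_mul, <- (Cmod_sqr x), <- (Cmod_sqr y).
  pose proof (Rle_0_sqr (Cmod x - Cmod y)); unfold Rsqr in *; lra.
Qed.

(** * Limits of complex sequences *)

Lemma Ccv_metric s l :
  Ccv s l <-> forall eps, 0 < eps ->
    exists N, forall n, (n >= N)%nat -> Cmod (s n - l)%Cx < eps.
Proof.
  split.
  - intros [H1 H2] eps He.
    destruct (H1 (eps / 2)) as [N1 HN1]; [lra |].
    destruct (H2 (eps / 2)) as [N2 HN2]; [lra |].
    exists (max N1 N2); intros n Hn.
    specialize (HN1 n ltac:(lia)); specialize (HN2 n ltac:(lia)).
    unfold R_dist in *.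
    eapply Rle_lt_trans; [apply Cmod_le_abs |]; simpl in *.
    unfold Rminus in *; lra.
  - intros H; split; intros eps He; destruct (H eps He) as [N HN];
      exists N; intros n Hn; specialize (HN n Hn); unfold R_dist.
    + eapply Rle_lt_trans; [| exact HN]; exact (Cmod_fst (s n - l)%Cx).
    + eapply Rle_lt_trans; [| exact HN]; exact (Cmod_snd (s n - l)%Cx).
Qed.

Lemma Ccv_unique s a b : Ccv s a -> Ccv s b -> a = b.
Proof.
  intros [H1 H2] [H3 H4]; apply Cx_ext; eapply UL_sequence; eassumption.
Qed.

Lemma Clim_eq s l : Ccv s l -> Clim s = l.
Proof.
  intros H; apply (Ccv_unique s); [| exact H].
  apply (epsilon_spec (inhabits C0) (fun l => Ccv s l)); exists l; exact H.
Qed.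

Lemma Rlim_eq s l : Un_cv s l -> Rlim s = l.
Proof.
  intros H; apply (UL_sequence s); [| exact H].
  apply (epsilon_spec (inhabits 0) (fun l => Un_cv s l)); exists l; exact H.
Qed.

Lemma Un_cv_const a : Un_cv (fun _ => a) a.
Proof.
  intros eps He; exists O; intros; unfold R_dist.
  rewrite Rminus_diag, Rabs_R0; exact He.
Qed.

Lemma Ccv_const a : Ccv (fun _ => a) a.
Proof. split; apply Un_cv_const. Qed.

Lemma Ccv_add s t a b :
  Ccv s a -> Ccv t b -> Ccv (fun n => s n + t n)%Cx (a + b)%Cx.
Proof.
  intros [H1 H2] [H3 H4]; split; simpl;
    [apply (CV_plus _ _ _ _ H1 H3) | apply (CV_plus _ _ _ _ H2 H4)].
Qed.

Lemma Ccv_mul s t a b :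
  Ccv s a -> Ccv t b -> Ccv (fun n => s n * t n)%Cx (a * b)%Cx.
Proof.
  intros [H1 H2] [H3 H4]; split; simpl.
  - exact (CV_minus _ _ _ _ (CV_mult _ _ _ _ H1 H3) (CV_mult _ _ _ _ H2 H4)).
  - exact (CV_plus _ _ _ _ (CV_mult _ _ _ _ H1 H4) (CV_mult _ _ _ _ H2 H3)).
Qed.

Lemma Ccv_conj s a : Ccv s a -> Ccv (fun n => Cconj (s n)) (Cconj a).
Proof.
  intros [H1 H2]; split; simpl; [exact H1 | exact (CV_opp _ _ H2)].
Qed.

Lemma Cmod_limit_le s l m :
  Ccv s l -> (exists N, forall n, (n >= N)%nat -> Cmod (s n) <= m) -> Cmod l <= m.
Proof.
  intros H [N HN]; apply Rnot_lt_le; intros Hlt.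
  destruct (proj1 (Ccv_metric s l) H (Cmod l - m)) as [N2 HN2]; [lra |].
  specialize (HN (max N N2) ltac:(lia)); specialize (HN2 (max N N2) ltac:(lia)).
  pose proof (Cmod_add (s (max N N2)) (l - s (max N N2))%Cx) as H1.
  replace (s (max N N2) + (l - s (max N N2)))%Cx with l in H1 by ring.
  rewrite Cmod_sub_sym in HN2; lra.
Qed.

(** * Absolutely summable families indexed by the integers *)

Lemma psumZR_ext u v N : (forall n, u n = v n) -> psumZR u N = psumZR v N.
Proof. intros H; induction N; simpl; rewrite ?IHN, !H; reflexivity. Qed.

Lemma psumZR_le u v N : (forall n, u n <= v n) -> psumZR u N <= psumZR v N.
Proof.
  intros H; induction N; cbn [psumZR]; [apply H |].
  pose proof (H (Z.of_nat (S N))); pose proof (H (- Z.of_nat (S N))%Z); lra.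
Qed.

Lemma psumZR_0 N : psumZR (fun _ => 0) N = 0.
Proof. induction N; simpl; lra. Qed.

Lemma psumZR_ge0 u N : (forall n, 0 <= u n) -> 0 <= psumZR u N.
Proof. intros H; rewrite <- (psumZR_0 N); apply psumZR_le; exact H. Qed.

Lemma psumZR_add u v N :
  psumZR (fun n => u n + v n) N = psumZR u N + psumZR v N.
Proof. induction N; cbn [psumZR]; [reflexivity | rewrite IHN; ring]. Qed.

Lemma psumZR_scal c u N : psumZR (fun n => c * u n) N = c * psumZR u N.
Proof. induction N; cbn [psumZR]; [reflexivity | rewrite IHN; ring]. Qed.

Lemma psumZR_growing u : (forall n, 0 <= u n) -> Un_growing (psumZR u).
Proof.
  intros H n; cbn [psumZR].
  pose proof (H (Z.of_nat (S n))); pose proof (H (- Z.of_nat (S n))%Z); lra.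
Qed.

Lemma psumZR_term u n :
  (forall n, 0 <= u n) -> u n <= psumZR u (Z.abs_nat n).
Proof.
  intros H.
  destruct (Z.abs_nat n) as [| N] eqn:E; cbn [psumZR].
  - replace n with 0%Z by lia; lra.
  - pose proof (psumZR_ge0 u N H).
    pose proof (H (Z.of_nat (S N))); pose proof (H (- Z.of_nat (S N))%Z).
    assert (n = Z.of_nat (S N) \/ n = (- Z.of_nat (S N))%Z) as [-> | ->] by lia;
      lra.
Qed.

Lemma psumZR_exchange (u : Z -> Z -> R) N K :
  psumZR (fun n => psumZR (u n) K) N = psumZR (fun k => psumZR (fun n => u n k) N) K.
Proof.
  induction N; cbn [psumZR]; [reflexivity |].
  rewrite IHN, <- !psumZR_add; reflexivity.
Qed.

(** For nonnegative families a uniform bound on the partial sums is equivalent to convergence;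
    keeping the constant explicit is what the rectangle estimates for double sums require. *)
Definition bounded_sums (u : Z -> R) (M : R) : Prop :=
  forall N, psumZR u N <= M.

Lemma bounded_sums_le u v M :
  (forall n, u n <= v n) -> bounded_sums v M -> bounded_sums u M.
Proof.
  intros H HM N; eapply Rle_trans; [apply psumZR_le; exact H | apply HM].
Qed.

Lemma bounded_sums_add u v M K :
  bounded_sums u M -> bounded_sums v K -> bounded_sums (fun n => u n + v n) (M + K).
Proof.
  intros H1 H2 N; rewrite psumZR_add; specialize (H1 N); specialize (H2 N); lra.
Qed.

Lemma bounded_sums_scal c u M :
  0 <= c -> bounded_sums u M -> bounded_sums (fun n => c * u n) (c * M).
Proof.
  intros Hc H N; rewrite psumZR_scal; apply Rmult_le_compat_l; auto.
Qed.

Lemma psumZR_opp u N : psumZR (fun n => u (- n)%Z) N = psumZR u N.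
Proof.
  induction N; cbn [psumZR]; [reflexivity |].
  rewrite IHN, Z.opp_involutive; ring.
Qed.

(** A unit shift moves the window of summation inside the next larger symmetric window, and
    positivity absorbs the two surplus terms. Negative shifts follow by reflection, which preserves
    symmetric partial sums. *)
Lemma bounded_sums_shift u M m :
  (forall n, 0 <= u n) -> bounded_sums u M -> bounded_sums (fun n => u (n + m)%Z) M.
Proof.
  assert (Hs : forall v N, (forall n, 0 <= v n) -> bounded_sums v N ->
                           bounded_sums (fun n => v (n + 1)%Z) N).
  { intros v N0 Hp Hv N.
    assert (E : psumZR (fun n => v (n + 1)%Z) N
                = psumZR v N + v (Z.of_nat (S N)) - v (- Z.of_nat N)%Z).
    { induction N; cbn [psumZR]; [simpl; ring |].
      rewrite IHN.
      replace (Z.of_nat (S N) + 1)%Z with (Z.of_nat (S (S N))) by lia.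
      replace (- Z.of_nat (S N) + 1)%Z with (- Z.of_nat N)%Z by lia. ring. }
    rewrite E.
    specialize (Hv (S N)); cbn [psumZR] in Hv.
    pose proof (Hp (- Z.of_nat (S N))%Z); pose proof (Hp (- Z.of_nat N)%Z); lra. }
  assert (Hn : forall k v N, (forall n, 0 <= v n) -> bounded_sums v N ->
                           bounded_sums (fun n => v (n + Z.of_nat k)%Z) N).
  { induction k; intros v N0 Hp Hv.
    - intros N; rewrite (psumZR_ext _ v) by (intros; f_equal; lia); apply Hv.
    - intros N.
      rewrite (psumZR_ext _ (fun n => (fun i => v (i + 1)%Z) (n + Z.of_nat k)%Z))
        by (intros; f_equal; lia).
      apply (IHk (fun i => v (i + 1)%Z)); [intros; apply Hp | auto]. }
  intros Hp Hu.
  destruct (Z_le_gt_dec 0 m).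
  - replace m with (Z.of_nat (Z.to_nat m)) by lia; auto.
  - intros N.
    rewrite <- psumZR_opp.
    rewrite (psumZR_ext _ (fun n => (fun i => u (- i)%Z) (n + Z.of_nat (Z.to_nat (- m)))%Z))
      by (intros; f_equal; lia).
    apply (Hn _ (fun i => u (- i)%Z)); [intros; apply Hp |].
    intros K; rewrite psumZR_opp; apply Hu.
Qed.

Lemma bounded_sums_reflect u M m :
  (forall n, 0 <= u n) -> bounded_sums u M -> bounded_sums (fun n => u (m - n)%Z) M.
Proof.
  intros Hp Hu N; rewrite <- psumZR_opp.
  rewrite (psumZR_ext _ (fun n => u (n + m)%Z)) by (intros; f_equal; lia).
  apply bounded_sums_shift; assumption.
Qed.

Lemma psumZR_cv u M :
  bounded_sums (fun n => Rabs (u n)) M -> exists l, Un_cv (psumZR u) l.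
Proof.
  intros H.
  assert (Hc : forall v K, (forall n, 0 <= v n) -> bounded_sums v K ->
                           exists l, Un_cv (psumZR v) l).
  { intros v K Hp Hv.
    destruct (growing_cv (psumZR v)) as [l Hl].
    - apply psumZR_growing; exact Hp.
    - exists K; intros x [N ->]; apply Hv.
    - exists l; exact Hl. }
  destruct (Hc (fun n => Rabs (u n)) M) as [a Ha];
    [intros; apply Rabs_pos | exact H |].
  (* Both [u + |u|] and [|u|] have monotone bounded partial sums, and [u] is their difference. *)
  destruct (Hc (fun n => u n + Rabs (u n)) (M + M)) as [b Hb].
  - intros n; pose proof (Rle_abs (- u n)); rewrite Rabs_Ropp in *; lra.
  - intros N; rewrite psumZR_add.
    pose proof (psumZR_le u (fun n => Rabs (u n)) N (fun n => Rle_abs _)).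
    specialize (H N); lra.
  - exists (b - a); intros eps He.
    destruct (CV_minus _ _ _ _ Hb Ha eps He) as [N HN].
    exists N; intros n Hn; specialize (HN n Hn); simpl in HN.
    rewrite psumZR_add in HN.
    replace (psumZR u n + psumZR (fun n0 => Rabs (u n0)) n - psumZR (fun n0 => Rabs (u n0)) n)
      with (psumZR u n) in HN by ring; exact HN.
Qed.

Definition ell1 (u : Z -> Cx) : Prop :=
  exists M, bounded_sums (fun n => Cmod (u n)) M.

Lemma psumZ_fst u N : fst (psumZ u N) = psumZR (fun n => fst (u n)) N.
Proof. induction N; simpl in *; [reflexivity | rewrite IHN; reflexivity]. Qed.
Lemma psumZ_snd u N : snd (psumZ u N) = psumZR (fun n => snd (u n)) N.
Proof. induction N; simpl in *; [reflexivity | rewrite IHN; reflexivity]. Qed.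

Lemma psumZ_add u v N :
  psumZ (fun n => u n + v n)%Cx N = (psumZ u N + psumZ v N)%Cx.
Proof. induction N; cbn [psumZ]; [reflexivity | rewrite IHN; ring]. Qed.

Lemma psumZ_scal c u N : psumZ (fun n => c * u n)%Cx N = (c * psumZ u N)%Cx.
Proof. induction N; cbn [psumZ]; [reflexivity | rewrite IHN; ring]. Qed.

Lemma psumZ_conj u N : psumZ (fun n => Cconj (u n)) N = Cconj (psumZ u N).
Proof. induction N; cbn [psumZ]; rewrite ?IHN, ?Cconj_add; reflexivity. Qed.

Lemma psumZ_opp u N : psumZ (fun n => u (- n)%Z) N = psumZ u N.
Proof.
  induction N; cbn [psumZ]; [reflexivity |].
  rewrite IHN, Z.opp_involutive; ring.
Qed.

Lemma Cmod_psumZ u N : Cmod (psumZ u N) <= psumZR (fun n => Cmod (u n)) N.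
Proof.
  induction N; cbn [psumZ psumZR]; [lra |].
  eapply Rle_trans; [apply Cmod_add |].
  apply Rplus_le_compat; [exact IHN | apply Cmod_add].
Qed.

Lemma Cmod_psumZ_tail u v N K :
  (forall n, Cmod (u n) <= v n) -> (N <= K)%nat ->
  Cmod (psumZ u K - psumZ u N)%Cx <= psumZR v K - psumZR v N.
Proof.
  intros H HN; induction HN as [| K HN IH].
  - replace (psumZ u N - psumZ u N)%Cx with C0 by ring; rewrite Cmod_C0; lra.
  - cbn [psumZ psumZR].
    set (x := u (Z.of_nat (S K))); set (y := u (- Z.of_nat (S K))%Z).
    replace (psumZ u K + (x + y) - psumZ u N)%Cx
      with ((psumZ u K - psumZ u N) + (x + y))%Cx by ring.
    pose proof (Cmod_add (psumZ u K - psumZ u N)%Cx (x + y)%Cx).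
    pose proof (Cmod_add x y).
    pose proof (H (Z.of_nat (S K))); pose proof (H (- Z.of_nat (S K))%Z).
    unfold x, y in *; lra.
Qed.

Lemma psumZ_cv u : ell1 u -> Ccv (psumZ u) (sumZ u).
Proof.
  intros [M HM].
  destruct (psumZR_cv (fun n => fst (u n)) M) as [a Ha].
  { apply (bounded_sums_le _ _ _ (fun n => Cmod_fst (u n)) HM). }
  destruct (psumZR_cv (fun n => snd (u n)) M) as [b Hb].
  { apply (bounded_sums_le _ _ _ (fun n => Cmod_snd (u n)) HM). }
  apply (epsilon_spec (inhabits C0) (fun l => Ccv (psumZ u) l)).
  exists (a, b); split; simpl.
  - intros eps He; destruct (Ha eps He) as [N HN]; exists N; intros.
    rewrite psumZ_fst; auto.
  - intros eps He; destruct (Hb eps He) as [N HN]; exists N; intros.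
    rewrite psumZ_snd; auto.
Qed.

Lemma sumZ_eq u l : Ccv (psumZ u) l -> sumZ u = l.
Proof. apply Clim_eq. Qed.

Lemma Cmod_sumZ_tail u v M N eps :
  (forall n, Cmod (u n) <= v n) -> bounded_sums v M ->
  (forall K, (K >= N)%nat -> psumZR v K - psumZR v N <= eps) ->
  Cmod (sumZ u - psumZ u N)%Cx <= eps.
Proof.
  intros H HM HN.
  apply (Cmod_limit_le (fun K => psumZ u K + - psumZ u N)%Cx).
  - apply Ccv_add; [| apply Ccv_const].
    apply psumZ_cv; exists M; eapply bounded_sums_le; eassumption.
  - exists N; intros K HK.
    eapply Rle_trans; [| exact (HN K HK)].
    apply Cmod_psumZ_tail; [exact H | lia].
Qed.

(* Tannery's theorem. *)
Lemma sumZ_dominated_cv (t : nat -> Z -> Cx) (s : Z -> Cx) v M :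
  (forall N k, Cmod (t N k) <= v k) -> bounded_sums v M ->
  (forall k, Ccv (fun N => t N k) (s k)) ->
  ell1 s /\ Ccv (fun N => sumZ (t N)) (sumZ s).
Proof.
  intros Ht HM Hc.
  assert (Hs : forall k, Cmod (s k) <= v k).
  { intros k; apply (Cmod_limit_le (fun N => t N k)); [apply Hc |].
    exists O; intros; apply Ht. }
  split; [exists M; eapply bounded_sums_le; eassumption |].
  apply Ccv_metric; intros eps He.
  assert (Hv0 : forall n, 0 <= v n)
    by (intros n; eapply Rle_trans; [apply Cmod_ge0 | apply (Hs n)]).
  destruct (growing_cv (psumZR v)) as [l Hl].
  { apply psumZR_growing; exact Hv0. }
  { exists M; intros x [N ->]; apply HM. }
  (* The cutoff [K] depends on the dominating family alone, so it controls the tails of [s] and of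
     all the [t n] at once. Only finitely many terms are left to converge, and three errors of at
     most [eps / 4] stay below [eps]. *)
  destruct (Hl (eps / 4)) as [K HK]; [lra |].
  assert (Htail : forall J, (J >= K)%nat -> psumZR v J - psumZR v K <= eps / 4).
  { intros J HJ; specialize (HK K ltac:(lia)).
    pose proof (growing_ineq _ _ (psumZR_growing v Hv0) Hl J).
    unfold R_dist in HK; apply Rabs_def2 in HK; lra. }
  assert (Hf : Ccv (fun N => psumZ (t N) K) (psumZ s K)).
  { clear -Hc; induction K; cbn [psumZ]; [apply Hc |].
    repeat apply Ccv_add; auto. }
  destruct (proj1 (Ccv_metric _ _) Hf (eps / 4)) as [N HN]; [lra |].
  exists N; intros n Hn; specialize (HN n Hn).
  pose proof (Cmod_sumZ_tail (t n) v M K _ (Ht n) HM Htail).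
  pose proof (Cmod_sumZ_tail s v M K _ Hs HM Htail) as H2.
  rewrite Cmod_sub_sym in H2.
  replace (sumZ (t n) - sumZ s)%Cx with
    ((sumZ (t n) - psumZ (t n) K) + ((psumZ (t n) K - psumZ s K) + (psumZ s K - sumZ s)))%Cx
    by ring.
  eapply Rle_lt_trans; [apply Cmod_add |].
  pose proof (Cmod_add (psumZ (t n) K - psumZ s K)%Cx (psumZ s K - sumZ s)%Cx).
  lra.
Qed.

Lemma ell1_add u v : ell1 u -> ell1 v -> ell1 (fun n => u n + v n)%Cx.
Proof.
  intros [M HM] [K HK]; exists (M + K).
  eapply bounded_sums_le; [| apply bounded_sums_add; eassumption].
  intros n; apply Cmod_add.
Qed.

Lemma ell1_scal c u : ell1 u -> ell1 (fun n => c * u n)%Cx.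
Proof.
  intros [M HM]; exists (Cmod c * M).
  eapply bounded_sums_le; [| apply bounded_sums_scal; [apply Cmod_ge0 | exact HM]].
  intros n; rewrite Cmod_mul; lra.
Qed.

Lemma ell1_conj u : ell1 u -> ell1 (fun n => Cconj (u n)).
Proof.
  intros [M HM]; exists M.
  eapply bounded_sums_le; [| exact HM]; intros n; rewrite Cmod_conj; lra.
Qed.

Lemma ell1_shift u m : ell1 u -> ell1 (fun n => u (n + m)%Z).
Proof.
  intros [M HM]; exists M.
  apply (bounded_sums_shift (fun n => Cmod (u n)));
    [intros; apply Cmod_ge0 | exact HM].
Qed.

Lemma ell1_reflect u m : ell1 u -> ell1 (fun n => u (m - n)%Z).
Proof.
  intros [M HM]; exists M.
  apply (bounded_sums_reflect (fun n => Cmod (u n)));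
    [intros; apply Cmod_ge0 | exact HM].
Qed.

Lemma sumZ_add u v :
  ell1 u -> ell1 v -> sumZ (fun n => u n + v n)%Cx = (sumZ u + sumZ v)%Cx.
Proof.
  intros Hu Hv; apply sumZ_eq.
  replace (psumZ (fun n => u n + v n)%Cx) with (fun N => psumZ u N + psumZ v N)%Cx
    by (extensionality N; symmetry; apply psumZ_add).
  apply Ccv_add; apply psumZ_cv; assumption.
Qed.

Lemma sumZ_scal c u : ell1 u -> sumZ (fun n => c * u n)%Cx = (c * sumZ u)%Cx.
Proof.
  intros Hu; apply sumZ_eq.
  replace (psumZ (fun n => c * u n)%Cx) with (fun N => c * psumZ u N)%Cx
    by (extensionality N; symmetry; apply psumZ_scal).
  apply Ccv_mul; [apply Ccv_const | apply psumZ_cv; assumption].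
Qed.

Lemma sumZ_conj u : ell1 u -> sumZ (fun n => Cconj (u n)) = Cconj (sumZ u).
Proof.
  intros Hu; apply sumZ_eq.
  replace (psumZ (fun n => Cconj (u n))) with (fun N => Cconj (psumZ u N))
    by (extensionality N; symmetry; apply psumZ_conj).
  apply Ccv_conj; apply psumZ_cv; assumption.
Qed.

Lemma sumZ_zero : sumZ (fun _ => C0) = C0.
Proof.
  apply sumZ_eq.
  replace (psumZ (fun _ => C0)) with (fun _ : nat => C0); [apply Ccv_const |].
  extensionality N; induction N; cbn [psumZ]; [reflexivity | rewrite <- IHN; ring].
Qed.

Lemma sumZ_opp u : sumZ (fun n => u (- n)%Z) = sumZ u.
Proof.
  unfold sumZ; f_equal; extensionality N; apply psumZ_opp.
Qed.

Lemma ell1_single f (m : Z) (c : Cx) :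
  f m = c -> (forall n, n <> m -> f n = C0) -> ell1 f /\ sumZ f = c.
Proof.
  intros Hm H.
  assert (E : forall N, (N >= Z.abs_nat m)%nat -> psumZ f N = c).
  { assert (E0 : forall N, (N < Z.abs_nat m)%nat -> psumZ f N = C0).
    { induction N; intros HN; cbn [psumZ]; [apply H; lia |].
      rewrite IHN, !H by lia; ring. }
    intros N HN; induction N as [| N IH]; cbn [psumZ].
    - rewrite <- Hm; f_equal; lia.
    - destruct (Nat.eq_dec (S N) (Z.abs_nat m)).
      + rewrite E0 by lia.
        destruct (Z_le_gt_dec 0 m).
        * rewrite (H (- _)%Z) by lia.
          replace (Z.of_nat (S N)) with m by lia; rewrite Hm; ring.
        * rewrite (H (Z.of_nat (S N))) by lia.
          replace (- Z.of_nat (S N))%Z with m by lia; rewrite Hm; ring.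
      + rewrite IH, !H by lia; ring. }
  split.
  - exists (Cmod c); intros N.
    assert (E0 : forall N, (N < Z.abs_nat m)%nat -> psumZR (fun n => Cmod (f n)) N = 0).
    { induction N0; intros HN; cbn [psumZR];
        [rewrite H by lia; apply Cmod_C0 |].
      rewrite IHN0, !H, Cmod_C0 by lia; ring. }
    induction N as [| N IH]; cbn [psumZR].
    + destruct (Z.eq_dec m 0) as [-> | ]; [rewrite Hm; lra |].
      rewrite H, Cmod_C0 by lia; apply Cmod_ge0.
    + destruct (Nat.eq_dec (S N) (Z.abs_nat m)).
      * rewrite E0 by lia.
        destruct (Z_le_gt_dec 0 m).
        -- rewrite (H (- _)%Z), Cmod_C0 by lia.
           replace (Z.of_nat (S N)) with m by lia; rewrite Hm; lra.
        -- rewrite (H (Z.of_nat (S N))), Cmod_C0 by lia.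
           replace (- Z.of_nat (S N))%Z with m by lia; rewrite Hm; lra.
      * rewrite !H, Cmod_C0 by lia; lra.
  - apply sumZ_eq, Ccv_metric; intros eps He.
    exists (Z.abs_nat m); intros n Hn; rewrite E by exact Hn.
    replace (c - c)%Cx with C0 by ring; rewrite Cmod_C0; exact He.
Qed.

Lemma sumZ_shift u m : ell1 u -> sumZ (fun n => u (n + m)%Z) = sumZ u.
Proof.
  assert (Hs : forall v, ell1 v -> sumZ (fun n => v (n + 1)%Z) = sumZ v).
  { intros v Hv; apply sumZ_eq.
    assert (E : psumZ (fun n => v (n + 1)%Z)
                = fun N => (psumZ v (S N) + - (v (- Z.of_nat N)%Z + v (- Z.of_nat (S N))%Z))%Cx).
    { extensionality N; induction N; cbn [psumZ] in *; [simpl; ring |].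
      rewrite IHN.
      replace (Z.of_nat (S N) + 1)%Z with (Z.of_nat (S (S N))) by lia.
      replace (- Z.of_nat (S N) + 1)%Z with (- Z.of_nat N)%Z by lia; ring. }
    rewrite E.
    assert (Hsum := psumZ_cv v Hv).
    assert (H1 : Ccv (fun N => psumZ v (S N)) (sumZ v)).
    { apply Ccv_metric; intros eps He.
      destruct (proj1 (Ccv_metric _ _) Hsum eps He) as [N HN].
      exists N; intros; apply HN; lia. }
    replace (sumZ v) with (sumZ v + - (C0 + C0))%Cx by ring.
    apply Ccv_add; [exact H1 |].
    (* The boundary terms left over by the shift vanish in the limit: their moduli are bounded by
       increments of a convergent series. *)
    assert (H0 : Ccv (fun N => v (- Z.of_nat N)%Z) C0).
    { destruct Hv as [M HM].
      destruct (psumZR_cv (fun n => Cmod (v n)) M) as [l Hl].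
      { intros N; rewrite (psumZR_ext _ (fun n => Cmod (v n))); [apply HM |].
        intros n; apply Rabs_right, Rle_ge, Cmod_ge0. }
      apply Ccv_metric; intros eps He.
      destruct (Hl (eps / 2)) as [N HN]; [lra |].
      exists (S N); intros n Hn; destruct n as [| n]; [lia |].
      pose proof (HN n ltac:(lia)) as Ha; pose proof (HN (S n) ltac:(lia)) as Hb.
      unfold R_dist in *; apply Rabs_def2 in Ha; apply Rabs_def2 in Hb.
      cbn [psumZR] in Hb.
      replace (v (- Z.of_nat (S n))%Z - C0)%Cx with (v (- Z.of_nat (S n))%Z) by ring.
      pose proof (Cmod_ge0 (v (Z.of_nat (S n)))); lra. }
    assert (H0' : Ccv (fun N => v (- Z.of_nat (S N))%Z) C0).
    { apply Ccv_metric; intros eps He.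
      destruct (proj1 (Ccv_metric _ _) H0 eps He) as [N HN].
      exists N; intros; apply HN; lia. }
    replace (fun n : nat => (- (v (- Z.of_nat n)%Z + v (- Z.of_nat (S n))%Z))%Cx)
      with (fun n : nat => ((- C1) * (v (- Z.of_nat n)%Z + v (- Z.of_nat (S n))%Z))%Cx)
      by (extensionality N; ring).
    replace (- (C0 + C0))%Cx with ((- C1) * (C0 + C0))%Cx by ring.
    apply Ccv_mul; [apply Ccv_const | apply Ccv_add; assumption]. }
  assert (Hn : forall k v, ell1 v -> sumZ (fun n => v (n + Z.of_nat k)%Z) = sumZ v).
  { induction k; intros v Hv.
    - f_equal; extensionality n; f_equal; lia.
    - rewrite <- (Hs v Hv), <- (IHk (fun i => v (i + 1)%Z)) by (apply ell1_shift, Hv).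
      f_equal; extensionality n; f_equal; lia. }
  intros Hu; destruct (Z_le_gt_dec 0 m).
  - replace m with (Z.of_nat (Z.to_nat m)) by lia; auto.
  - rewrite <- (Hn (Z.to_nat (- m)) (fun n => u (n + m)%Z)) by (apply ell1_shift, Hu).
    f_equal; extensionality n; f_equal; lia.
Qed.

Lemma sumZ_reflect u m : ell1 u -> sumZ (fun n => u (m - n)%Z) = sumZ u.
Proof.
  intros Hu; rewrite <- sumZ_opp, <- (sumZ_shift u m Hu).
  f_equal; extensionality n; f_equal; lia.
Qed.

(** For finitely many rows the interchange is additivity of [sumZ]. Dominated convergence passes to
    all rows, with the column sums of the moduli as dominating family. *)
Lemma sumZ_fubini (u : Z -> Z -> Cx) M :
  (forall K, bounded_sums (fun n => psumZR (fun k => Cmod (u n k)) K) M) ->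
  (forall n, ell1 (u n)) /\ (forall k, ell1 (fun n => u n k)) /\
  ell1 (fun n => sumZ (u n)) /\ ell1 (fun k => sumZ (fun n => u n k)) /\
  sumZ (fun n => sumZ (u n)) = sumZ (fun k => sumZ (fun n => u n k)).
Proof.
  assert (Hmain : forall (u : Z -> Z -> Cx),
    (forall K, bounded_sums (fun n => psumZR (fun k => Cmod (u n k)) K) M) ->
    (forall n, ell1 (u n)) /\ (forall k, ell1 (fun n => u n k)) /\
    ell1 (fun k => sumZ (fun n => u n k)) /\
    sumZ (fun n => sumZ (u n)) = sumZ (fun k => sumZ (fun n => u n k))).
  { clear u; intros u H.
    assert (Hrow : forall n, ell1 (u n)).
    { intros n; exists M; intros K.
      eapply Rle_trans; [| exact (H K (Z.abs_nat n))].
      apply (psumZR_term (fun n => psumZR (fun k => Cmod (u n k)) K)).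
      intros; apply psumZR_ge0; intros; apply Cmod_ge0. }
    assert (Hcol : forall k, bounded_sums (fun n => Cmod (u n k)) M).
    { intros k N.
      eapply Rle_trans; [| exact (H (Z.abs_nat k) N)].
      rewrite psumZR_exchange.
      apply (psumZR_term (fun k => psumZR (fun n => Cmod (u n k)) N)).
      intros; apply psumZR_ge0; intros; apply Cmod_ge0. }
    split; [exact Hrow |]; split; [intros k; exists M; apply Hcol |].
    set (v := fun k => Rlim (psumZR (fun n => Cmod (u n k)))).
    assert (Hv : forall k, Un_cv (psumZR (fun n => Cmod (u n k))) (v k)).
    { intros k; destruct (psumZR_cv (fun n => Cmod (u n k)) M) as [l Hl].
      - intros N; rewrite (psumZR_ext _ (fun n => Cmod (u n k))); [apply Hcol |].
        intros n; apply Rabs_right, Rle_ge, Cmod_ge0.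
      - unfold v; rewrite (Rlim_eq _ _ Hl); exact Hl. }
    destruct (sumZ_dominated_cv (fun N k => psumZ (fun n => u n k) N)
                (fun k => sumZ (fun n => u n k)) v M) as [H1 H2].
    - intros N k; eapply Rle_trans; [apply Cmod_psumZ |].
      apply growing_ineq; [apply psumZR_growing; intros; apply Cmod_ge0 | apply Hv].
    (* A partial sum of [v] is a limit of sums over finite rectangles, so if it exceeded [M], some
       finite rectangle would too. *)
    - intros K; apply Rnot_lt_le; intros Hlt.
      assert (Hl : Un_cv (fun N => psumZR (fun k => psumZR (fun n => Cmod (u n k)) N) K)
                         (psumZR v K)).
      { clear -Hv; induction K; cbn [psumZR]; [apply Hv |].
        apply (CV_plus _ _ _ _ IHK).
        apply (CV_plus _ _ _ _ (Hv _) (Hv _)). }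
      destruct (Hl (psumZR v K - M)) as [N HN]; [lra |].
      specialize (HN N ltac:(lia)); unfold R_dist in HN; apply Rabs_def2 in HN.
      rewrite <- psumZR_exchange in HN; specialize (H K N); lra.
    - intros k; apply psumZ_cv; exists M; apply Hcol.
    - split; [exact H1 |]; apply sumZ_eq.
      replace (psumZ (fun n => sumZ (u n)))
        with (fun N => sumZ (fun k => psumZ (fun n => u n k) N)); [exact H2 |].
      extensionality N.
      assert (Hfin : ell1 (fun k => psumZ (fun n => u n k) N) /\
                     sumZ (fun k => psumZ (fun n => u n k) N) = psumZ (fun n => sumZ (u n)) N).
      { clear -Hrow; induction N; cbn [psumZ]; [split; auto |].
        destruct IHN as [IH1 IH2].
        assert (Ha := ell1_add _ _ (Hrow (Z.of_nat (S N))) (Hrow (- Z.of_nat (S N))%Z)).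
        split; [exact (ell1_add _ _ IH1 Ha) |].
        rewrite (sumZ_add _ _ IH1 Ha), sumZ_add, IH2; auto. }
      apply Hfin. }
  (* The rectangle bound is symmetric in the two indices, so the transposed family supplies
     summability of the row sums. *)
  intros H; destruct (Hmain u H) as [H1 [H2 [H3 H4]]].
  destruct (Hmain (fun k n => u n k)) as [_ [_ [H5 _]]].
  - intros K N; rewrite psumZR_exchange; apply H.
  - repeat split; assumption.
Qed.

(** * The module of square summable sequences over the convolution algebra *)

Definition bounded_energy (f : seqZ) (M : R) : Prop :=
  bounded_sums (fun n => Cnorm2 (f n)) M.

Lemma l2_iff f : l2 f <-> exists M, bounded_energy f M.
Proof.
  split.
  - intros [l Hl]; exists l; intros N.
    apply growing_ineq; [apply psumZR_growing; intros; apply Cnorm2_ge0 | exact Hl].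
  - intros [M HM]; apply (psumZR_cv _ M); intros N.
    rewrite (psumZR_ext _ (fun n => Cnorm2 (f n))); [apply HM |].
    intros n; apply Rabs_right, Rle_ge, Cnorm2_ge0.
Qed.

Lemma nsq_cv f : l2 f -> Un_cv (psumZR (fun n => Cnorm2 (f n))) (nsq f).
Proof. intros [l Hl]; unfold nsq; rewrite (Rlim_eq _ _ Hl); exact Hl. Qed.

Lemma nsq_energy f : l2 f -> bounded_energy f (nsq f).
Proof.
  intros Hf N; apply growing_ineq; [| apply nsq_cv, Hf].
  apply psumZR_growing; intros; apply Cnorm2_ge0.
Qed.

Lemma nsq_le f M : l2 f -> bounded_energy f M -> nsq f <= M.
Proof.
  intros Hf HM; apply Rnot_lt_le; intros Hlt.
  destruct (nsq_cv f Hf (nsq f - M)) as [N HN]; [lra |].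
  specialize (HN N ltac:(lia)); unfold R_dist in HN; apply Rabs_def2 in HN.
  specialize (HM N); lra.
Qed.

Lemma Cnorm2_add_le x y : Cnorm2 (x + y)%Cx <= 2 * Cnorm2 x + 2 * Cnorm2 y.
Proof.
  destruct x as [a b], y as [c d]; unfold Cnorm2; simpl.
  pose proof (Rle_0_sqr (a - c)); pose proof (Rle_0_sqr (b - d)).
  unfold Rsqr in *; lra.
Qed.

Lemma Cnorm2_mul x y : Cnorm2 (x * y)%Cx = Cnorm2 x * Cnorm2 y.
Proof. unfold Cnorm2; simpl; ring. Qed.

Lemma Cnorm2_conj x : Cnorm2 (Cconj x) = Cnorm2 x.
Proof. unfold Cnorm2; simpl; ring. Qed.

Lemma l2_add f g : l2 f -> l2 g -> l2 (sadd f g).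
Proof.
  rewrite !l2_iff; intros [M HM] [K HK]; exists (2 * M + 2 * K).
  eapply bounded_sums_le; [intros n; apply Cnorm2_add_le |].
  apply bounded_sums_add; apply bounded_sums_scal; auto; lra.
Qed.

Lemma l2_scal c f : l2 f -> l2 (sscal c f).
Proof.
  rewrite !l2_iff; intros [M HM]; exists (Cnorm2 c * M).
  eapply bounded_sums_le; [| apply bounded_sums_scal; [apply Cnorm2_ge0 | exact HM]].
  intros n; unfold sscal; rewrite Cnorm2_mul; lra.
Qed.

Lemma ssub_eq f g : ssub f g = sadd f (sscal (- C1)%Cx g).
Proof. extensionality n; unfold ssub, sadd, sscal; ring. Qed.

Lemma l2_sub f g : l2 f -> l2 g -> l2 (ssub f g).
Proof. intros; rewrite ssub_eq; apply l2_add; [| apply l2_scal]; assumption. Qed.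

Lemma l2_zero : l2 szero.
Proof.
  apply l2_iff; exists 0; intros N.
  rewrite (psumZR_ext _ (fun _ => 0)), psumZR_0; [lra |].
  intros; unfold Cnorm2; simpl; ring.
Qed.

Lemma l2_le f g : (forall n, Cnorm2 (f n) <= Cnorm2 (g n)) -> l2 g -> l2 f.
Proof.
  rewrite !l2_iff; intros H [M HM]; exists M.
  exact (bounded_sums_le _ _ _ H HM).
Qed.

Lemma l2_shift f m : l2 f -> l2 (fun n => f (n + m)%Z).
Proof.
  rewrite !l2_iff; intros [M HM]; exists M.
  apply (bounded_sums_shift (fun n => Cnorm2 (f n)));
    [intros; apply Cnorm2_ge0 | exact HM].
Qed.

Lemma l2_reflect f m : l2 f -> l2 (fun n => f (m - n)%Z).
Proof.
  rewrite !l2_iff; intros [M HM]; exists M.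
  apply (bounded_sums_reflect (fun n => Cnorm2 (f n)));
    [intros; apply Cnorm2_ge0 | exact HM].
Qed.

Lemma l2_conj_reflect f m : l2 f -> l2 (fun n => Cconj (f (m - n)%Z)).
Proof.
  intros H; apply (l2_le _ (fun n => f (m - n)%Z)); [| apply l2_reflect, H].
  intros n; rewrite Cnorm2_conj; lra.
Qed.

Lemma cstar_eq f : cstar f = fun n => Cconj (f (0 - n)%Z).
Proof. reflexivity. Qed.

Lemma l2_cstar f : l2 f -> l2 (cstar f).
Proof. rewrite cstar_eq; apply l2_conj_reflect. Qed.

Lemma ell1_cstar f : ell1 f -> ell1 (cstar f).
Proof.
  intros H; rewrite cstar_eq; apply ell1_conj, (ell1_reflect f 0 H).
Qed.

Lemma cstar_cstar f : cstar (cstar f) = f.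
Proof.
  extensionality n; unfold cstar; rewrite Z.opp_involutive; apply Cconj_conj.
Qed.

(** An [ell1] bound [M] is also a bound on each term, whence [|f n|^2 <= M |f n|]. *)
Lemma ell1_l2 f : ell1 f -> l2 f.
Proof.
  intros [M HM]; apply l2_iff; exists (M * M); intros N.
  eapply Rle_trans; [apply (psumZR_le _ (fun n => M * Cmod (f n))) |].
  - intros n; rewrite <- Cmod_sqr; apply Rmult_le_compat_r; [apply Cmod_ge0 |].
    eapply Rle_trans; [| apply (HM (Z.abs_nat n))].
    apply (psumZR_term (fun n => Cmod (f n))); intros; apply Cmod_ge0.
  - rewrite psumZR_scal; apply Rmult_le_compat_l; [| apply HM].
    eapply Rle_trans; [| apply (HM O)]; apply Cmod_ge0.
Qed.

Lemma ell1_mul f g M K :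
  bounded_energy f M -> bounded_energy g K ->
  bounded_sums (fun n => Cmod (f n * g n)%Cx) ((M + K) / 2).
Proof.
  intros HM HK N.
  eapply Rle_trans; [apply psumZR_le; intros; apply Cmod_mul_le |].
  rewrite (psumZR_ext _ (fun n => (/ 2) * (Cnorm2 (f n) + Cnorm2 (g n))))
    by (intros; field).
  rewrite psumZR_scal, psumZR_add; specialize (HM N); specialize (HK N).
  unfold bounded_energy in *; lra.
Qed.

Lemma l2_mul_ell1 f g : l2 f -> l2 g -> ell1 (fun n => f n * g n)%Cx.
Proof.
  rewrite !l2_iff; intros [M HM] [K HK]; eexists.
  apply ell1_mul; eassumption.
Qed.

Lemma ip_summand f g : l2 f -> l2 g -> ell1 (fun n => f n * Cconj (g n))%Cx.
Proof.
  intros Hf Hg; apply l2_mul_ell1; [exact Hf |].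
  apply (l2_le _ g); [| exact Hg]; intros; rewrite Cnorm2_conj; lra.
Qed.

Lemma ip_add_l f g h : l2 f -> l2 g -> l2 h -> ip (sadd f g) h = (ip f h + ip g h)%Cx.
Proof.
  intros; unfold ip; rewrite <- sumZ_add by (apply ip_summand; assumption).
  f_equal; extensionality n; unfold sadd; ring.
Qed.

Lemma ip_scal_l c f h : l2 f -> l2 h -> ip (sscal c f) h = (c * ip f h)%Cx.
Proof.
  intros; unfold ip; rewrite <- sumZ_scal by (apply ip_summand; assumption).
  f_equal; extensionality n; unfold sscal; ring.
Qed.

Lemma ip_conj f g : l2 f -> l2 g -> ip g f = Cconj (ip f g).
Proof.
  intros; unfold ip; rewrite <- sumZ_conj by (apply ip_summand; assumption).
  f_equal; extensionality n; rewrite Cconj_mul, Cconj_conj; ring.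
Qed.

Lemma ip_sub_l f g h : l2 f -> l2 g -> l2 h -> ip (ssub f g) h = (ip f h - ip g h)%Cx.
Proof.
  intros; rewrite ssub_eq, ip_add_l, ip_scal_l; auto using l2_scal; ring.
Qed.

Lemma ip_add_r f g h : l2 f -> l2 g -> l2 h -> ip h (sadd f g) = (ip h f + ip h g)%Cx.
Proof.
  intros; rewrite (ip_conj (sadd f g)), (ip_conj f), (ip_conj g), ip_add_l, Cconj_add;
    auto using l2_add.
Qed.

Lemma ip_scal_r c f h : l2 f -> l2 h -> ip h (sscal c f) = (Cconj c * ip h f)%Cx.
Proof.
  intros; rewrite (ip_conj (sscal c f)), (ip_conj f), ip_scal_l, Cconj_mul;
    auto using l2_scal.
Qed.

Lemma ip_zero f g : (forall n, f n = C0 \/ g n = C0) -> ip f g = C0.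
Proof.
  intros H; unfold ip.
  replace (fun n => (f n * Cconj (g n))%Cx) with (fun _ : Z => C0); [apply sumZ_zero |].
  extensionality n; destruct (H n) as [-> | ->]; rewrite ?Cconj_0; ring.
Qed.

Lemma ip_self f : l2 f -> ip f f = (nsq f, 0).
Proof.
  intros Hf; apply sumZ_eq.
  replace (psumZ (fun n => f n * Cconj (f n))%Cx)
    with (fun N => (psumZR (fun n => Cnorm2 (f n)) N, 0)).
  - split; simpl; [apply nsq_cv, Hf | apply Un_cv_const].
  - extensionality N; induction N; cbn [psumZ psumZR];
      rewrite ?Cmul_conj; [reflexivity |].
    rewrite <- IHN; apply Cx_ext; simpl; ring.
Qed.

Lemma ip_self_eq0 f : l2 f -> ip f f = C0 -> f = szero.
Proof.
  intros Hf H; rewrite (ip_self f Hf) in H; injection H as H.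
  extensionality n; apply Cnorm2_eq0.
  pose proof (psumZR_term (fun n => Cnorm2 (f n)) n (fun n => Cnorm2_ge0 _)) as H1.
  pose proof (nsq_energy f Hf (Z.abs_nat n)).
  pose proof (Cnorm2_ge0 (f n)); simpl in H1; lra.
Qed.

Lemma ssub_zero f g : ssub f g = szero -> f = g.
Proof.
  intros H; extensionality n; pose proof (equal_f H n) as E.
  unfold ssub, szero in E.
  replace (f n) with ((f n + - g n) + g n)%Cx by ring; rewrite E; ring.
Qed.

Lemma ip_conj_shift f g m :
  l2 f -> l2 g ->
  ip (fun n => Cconj (f (m - n)%Z)) (fun n => Cconj (g (m - n)%Z)) = ip g f.
Proof.
  intros Hf Hg; unfold ip.
  rewrite <- (sumZ_reflect _ m (ip_summand g f Hg Hf)).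
  f_equal; extensionality n; rewrite Cconj_conj; ring.
Qed.

(** * Convolution, Young's inequality and adjoints *)

Lemma conv_summand f g n : l2 f -> l2 g -> ell1 (fun k => f (n - k)%Z * g k)%Cx.
Proof.
  intros; apply (l2_mul_ell1 (fun k => f (n - k)%Z)); [apply l2_reflect |]; assumption.
Qed.

Lemma conv_comm f g : l2 f -> l2 g -> conv f g = conv g f.
Proof.
  intros Hf Hg; extensionality n; unfold conv.
  rewrite <- (sumZ_reflect _ n (conv_summand f g n Hf Hg)).
  f_equal; extensionality k; replace (n - (n - k))%Z with k by lia; ring.
Qed.

Lemma conv_add_r f g h : l2 f -> l2 g -> l2 h -> conv f (sadd g h) = sadd (conv f g) (conv f h).
Proof.
  intros; extensionality n; unfold conv, sadd.
  rewrite <- sumZ_add by (apply conv_summand; assumption).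
  f_equal; extensionality k; ring.
Qed.

Lemma conv_scal_r c f g : l2 f -> l2 g -> conv f (sscal c g) = sscal c (conv f g).
Proof.
  intros; extensionality n; unfold conv, sscal.
  rewrite <- sumZ_scal by (apply conv_summand; assumption).
  f_equal; extensionality k; ring.
Qed.

Lemma conv_add_l f g h : l2 f -> l2 g -> l2 h -> conv (sadd f g) h = sadd (conv f h) (conv g h).
Proof.
  intros; rewrite !(conv_comm _ h) by auto using l2_add; apply conv_add_r; assumption.
Qed.

Lemma conv_scal_l c f g : l2 f -> l2 g -> conv (sscal c f) g = sscal c (conv f g).
Proof.
  intros; rewrite !(conv_comm _ g) by auto using l2_scal; apply conv_scal_r; assumption.
Qed.

Lemma conv_sub_r f g h : l2 f -> l2 g -> l2 h -> conv f (ssub g h) = ssub (conv f g) (conv f h).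
Proof.
  intros; rewrite !ssub_eq, conv_add_r, conv_scal_r; auto using l2_scal.
Qed.

Lemma conv_delta0_l f : conv delta0 f = f.
Proof.
  extensionality n; unfold conv.
  apply (ell1_single _ n).
  - rewrite Z.sub_diag; unfold delta0; simpl; ring.
  - intros k Hk; unfold delta0.
    destruct (Z.eqb_spec (n - k) 0); [lia | ring].
Qed.

Lemma ell1_delta0 : ell1 delta0.
Proof.
  apply (ell1_single _ 0%Z C1); [reflexivity |].
  intros n Hn; unfold delta0; destruct (Z.eqb_spec n 0); [lia | reflexivity].
Qed.

(** Each inner sum runs over a translate of [a], hence is at most [A]. This supplies the absolute
    bound for the Fubini arguments about convolutions. *)
Lemma weighted_rectangle a (u : Z -> R) A M :
  (forall n, 0 <= u n) -> bounded_sums (fun n => Cmod (a n)) A -> bounded_sums u M ->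
  forall N K, psumZR (fun k => psumZR (fun n => u k * Cmod (a (n - k)%Z)) N) K <= A * M.
Proof.
  intros Hu HA HM N K.
  assert (HA0 : 0 <= A) by (eapply Rle_trans; [| apply (HA O)]; apply Cmod_ge0).
  eapply Rle_trans; [apply (psumZR_le _ (fun k => A * u k)) |].
  - intros k; rewrite psumZR_scal, Rmult_comm; apply Rmult_le_compat_r; [apply Hu |].
    apply (bounded_sums_shift (fun n => Cmod (a n)) A (- k)%Z);
      [intros; apply Cmod_ge0 | exact HA].
  - rewrite psumZR_scal; apply Rmult_le_compat_l; [exact HA0 | apply HM].
Qed.

Lemma ell1_conv a b : ell1 a -> ell1 b -> ell1 (conv a b).
Proof.
  intros [A HA] [B HB].
  destruct (sumZ_fubini (fun n k => a (n - k)%Z * b k)%Cx (A * B)) as [_ [_ [H _]]];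
    [| exact H].
  intros K N.
  eapply Rle_trans;
    [| exact (weighted_rectangle a (fun k => Cmod (b k)) A B (fun _ => Cmod_ge0 _) HA HB N K)].
  rewrite psumZR_exchange; apply psumZR_le; intros k; apply psumZR_le; intros n.
  rewrite Cmod_mul; lra.
Qed.

(** Young's inequality for [ell1] acting on [l2], in squared form. After commuting the factors, a
    truncated convolution is a finite combination of translates of [f] with weights [a m], and
    translates have the same energy bound. *)
Lemma conv_ell1_energy a f A M :
  0 < A -> bounded_sums (fun n => Cmod (a n)) A -> bounded_energy f M ->
  bounded_energy (conv a f) (A * A * M).
Proof.
  intros HA0 HA HM N.
  assert (Hf : l2 f) by (apply l2_iff; exists M; exact HM).
  assert (Ha : l2 a) by (apply ell1_l2; exists A; exact HA).
  rewrite (conv_comm a f Ha Hf).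
  set (c := fun K n => psumZ (fun m => f (n - m)%Z * a m)%Cx K).
  set (w := fun K n => psumZR (fun m => Cmod (a m) * Cnorm2 (f (n - m)%Z)) K).
  assert (HM0 : 0 <= M) by (eapply Rle_trans; [| apply (HM O)]; apply Cnorm2_ge0).
  (* AM-GM: [2 |a| |f| |c| <= |a| (A |f|^2 + |c|^2 / A)], summed over [m]. *)
  assert (Hc : forall K n, Cnorm2 (c K n) <= A * w K n).
  { intros K n.
    assert (H1 : Cmod (c K n) * Cmod (c K n)
                 <= psumZR (fun m => Cmod (c K n) * (Cmod (a m) * Cmod (f (n - m)%Z))) K).
    { rewrite psumZR_scal; apply Rmult_le_compat_l; [apply Cmod_ge0 |].
      eapply Rle_trans; [apply Cmod_psumZ |].
      apply psumZR_le; intros; rewrite Cmod_mul; lra. }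
    assert (H2 : psumZR (fun m => Cmod (c K n) * (Cmod (a m) * Cmod (f (n - m)%Z))) K
                 <= A / 2 * w K n
                    + Cnorm2 (c K n) / (2 * A) * psumZR (fun m => Cmod (a m)) K).
    { unfold w; rewrite <- !psumZR_scal, <- psumZR_add; apply psumZR_le; intros m.
      rewrite <- !Cmod_sqr.
      set (x := Cmod (c K n)); set (y := Cmod (f (n - m)%Z)).
      replace (A / 2 * (Cmod (a m) * (y * y)) + x * x / (2 * A) * Cmod (a m))
        with (x * (Cmod (a m) * y) + Cmod (a m) * ((A * y - x) * (A * y - x)) * / (2 * A))
        by (field; lra).
      assert (0 <= Cmod (a m) * ((A * y - x) * (A * y - x)) * / (2 * A)); [| lra].
      apply Rmult_le_pos; [apply Rmult_le_pos; [apply Cmod_ge0 | apply Rle_0_sqr] |].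
      left; apply Rinv_0_lt_compat; lra. }
    assert (H3 : Cnorm2 (c K n) / (2 * A) * psumZR (fun m => Cmod (a m)) K
                 <= Cnorm2 (c K n) / 2).
    { replace (Cnorm2 (c K n) / 2) with (Cnorm2 (c K n) / (2 * A) * A) by (field; lra).
      apply Rmult_le_compat_l; [| apply HA].
      apply Rmult_le_pos; [apply Cnorm2_ge0 | left; apply Rinv_0_lt_compat; lra]. }
    rewrite Cmod_sqr in H1; lra. }
  assert (Hb : forall K, psumZR (fun n => Cnorm2 (c K n)) N <= A * A * M).
  { intros K.
    eapply Rle_trans; [apply psumZR_le; intros; apply Hc |].
    rewrite psumZR_scal, Rmult_assoc; apply Rmult_le_compat_l; [lra |].
    unfold w; rewrite psumZR_exchange.
    eapply Rle_trans; [apply (psumZR_le _ (fun m => M * Cmod (a m))) |].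
    - intros m; rewrite psumZR_scal, Rmult_comm.
      apply Rmult_le_compat_r; [apply Cmod_ge0 |].
      apply (bounded_sums_shift (fun n => Cnorm2 (f n)));
        [intros; apply Cnorm2_ge0 | exact HM].
    - rewrite psumZR_scal, Rmult_comm; apply Rmult_le_compat_r; [exact HM0 | apply HA]. }
  (* The bound on truncations is independent of [K]. With [N] fixed only finitely many coefficients
     occur, so it survives the limit in [K]. *)
  assert (Hl : Un_cv (fun K => psumZR (fun n => Cnorm2 (c K n)) N)
                     (psumZR (fun n => Cnorm2 (conv f a n)) N)).
  { assert (Hpt : forall n, Un_cv (fun K => Cnorm2 (c K n)) (Cnorm2 (conv f a n))).
    { intros n; destruct (psumZ_cv _ (conv_summand f a n Hf Ha)) as [H1 H2].
      exact (CV_plus _ _ _ _ (CV_mult _ _ _ _ H1 H1) (CV_mult _ _ _ _ H2 H2)). }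
    clear -Hpt; induction N; cbn [psumZR]; [apply Hpt |].
    apply (CV_plus _ _ _ _ IHN), (CV_plus _ _ _ _ (Hpt _) (Hpt _)). }
  apply Rnot_lt_le; intros Hlt.
  destruct (Hl (psumZR (fun n => Cnorm2 (conv f a n)) N - A * A * M)) as [K HK]; [lra |].
  specialize (HK K ltac:(lia)); specialize (Hb K); unfold R_dist in HK.
  apply Rabs_def2 in HK; lra.
Qed.

Lemma ell1_bound_pos a : ell1 a -> exists A, 0 < A /\ bounded_sums (fun n => Cmod (a n)) A.
Proof.
  intros [A HA]; exists (Rabs A + 1); split; [pose proof (Rabs_pos A); lra |].
  intros N; specialize (HA N); pose proof (Rle_abs A); lra.
Qed.

Lemma l2_conv_ell1 a f : ell1 a -> l2 f -> l2 (conv a f).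
Proof.
  rewrite !l2_iff; intros Ha [M HM].
  destruct (ell1_bound_pos a Ha) as [A [HA0 HA]].
  exists (A * A * M); apply conv_ell1_energy; assumption.
Qed.

(** Fubini for [a(n-k) f(k) conj(g(n))]. The inequality [|f g| <= (|f|^2 + |g|^2) / 2] splits the
    double sum into two weighted rectangles, one for each summand of the constant. *)
Lemma ip_conv_adjoint a f g :
  ell1 a -> l2 f -> l2 g -> ip (conv a f) g = ip f (conv (cstar a) g).
Proof.
  intros Ha Hf Hg.
  assert (Ha2 := ell1_l2 a Ha).
  destruct Ha as [A HA]; apply l2_iff in Hf as HM; destruct HM as [M HM];
    apply l2_iff in Hg as HK; destruct HK as [K HK].
  destruct (sumZ_fubini (fun n k => a (n - k)%Z * f k * Cconj (g n))%Cx
              (/ 2 * (A * M) + / 2 * (A * K))) as [_ [_ [_ [_ E]]]].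
  { intros J N.
    eapply Rle_trans with
      (psumZR (fun n => psumZR (fun k => / 2 * (Cnorm2 (f k) * Cmod (a (n - k)%Z))
                                       + / 2 * (Cnorm2 (g n) * Cmod (a (n - k)%Z))) J) N).
    - apply psumZR_le; intros n; apply psumZR_le; intros k.
      replace (a (n - k)%Z * f k * Cconj (g n))%Cx with (a (n - k)%Z * (f k * Cconj (g n)))%Cx
        by ring.
      rewrite Cmod_mul.
      pose proof (Cmod_mul_le (f k) (Cconj (g n))) as H; rewrite Cnorm2_conj in H.
      apply (Rmult_le_compat_l (Cmod (a (n - k)%Z))) in H; [lra | apply Cmod_ge0].
    - rewrite (psumZR_ext _ (fun n =>
          / 2 * psumZR (fun k => Cnorm2 (f k) * Cmod (a (n - k)%Z)) J
          + / 2 * psumZR (fun k => Cnorm2 (g n) * Cmod (a (n - k)%Z)) J))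
        by (intros; rewrite psumZR_add, !psumZR_scal; reflexivity).
      rewrite psumZR_add, !psumZR_scal.
      apply Rplus_le_compat; apply Rmult_le_compat_l; try lra.
      + rewrite psumZR_exchange.
        apply weighted_rectangle; [intros; apply Cnorm2_ge0 | exact HA | exact HM].
      (* Here the weight sits on the outer index, so the rectangle is read with the reflected kernel
         [a(-i)]. *)
      + rewrite (psumZR_ext _ (fun n =>
          psumZR (fun k => Cnorm2 (g n) * Cmod (a (- (k - n))%Z)) J))
          by (intros; apply psumZR_ext; intros; do 2 f_equal; f_equal; lia).
        apply (weighted_rectangle (fun i => a (- i)%Z));
          [intros; apply Cnorm2_ge0 | | exact HK].
        apply (bounded_sums_reflect (fun n => Cmod (a n)) A 0);
          [intros; apply Cmod_ge0 | exact HA]. }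
  transitivity (sumZ (fun n => sumZ (fun k => a (n - k)%Z * f k * Cconj (g n))))%Cx.
  - unfold ip; f_equal; extensionality n; unfold conv.
    transitivity (Cconj (g n) * sumZ (fun k => a (n - k)%Z * f k))%Cx; [ring |].
    rewrite <- sumZ_scal by (apply conv_summand; assumption).
    f_equal; extensionality k; ring.
  - rewrite E; unfold ip; f_equal; extensionality k; unfold conv.
    rewrite <- sumZ_conj by (apply conv_summand; auto using l2_cstar).
    rewrite <- sumZ_scal
      by (apply ell1_conj, conv_summand; auto using l2_cstar).
    f_equal; extensionality n; unfold cstar.
    rewrite Cconj_mul, Cconj_conj.
    replace (- (k - n))%Z with (n - k)%Z by lia; ring.
Qed.

Lemma ip_conv_adjoint_star a f g :
  ell1 a -> l2 f -> l2 g -> ip (conv (cstar a) f) g = ip f (conv a g).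
Proof.
  intros; rewrite ip_conv_adjoint, cstar_cstar; auto using ell1_cstar.
Qed.

Lemma conv_as_ip a f n :
  l2 a -> l2 f -> conv a f n = ip f (fun k => cstar a (k + - n)%Z).
Proof.
  intros; unfold conv, ip; f_equal; extensionality k; unfold cstar.
  rewrite Cconj_conj; replace (- (k + - n))%Z with (n - k)%Z by lia; ring.
Qed.

Lemma cstar_conv f g : l2 f -> l2 g -> cstar (conv f g) = conv (cstar f) (cstar g).
Proof.
  intros; extensionality n; unfold cstar at 1, conv.
  rewrite <- sumZ_conj, <- sumZ_opp by (apply conv_summand; assumption).
  f_equal; extensionality k; unfold cstar; rewrite Cconj_mul.
  replace (- (n - k))%Z with (- n - - k)%Z by lia; reflexivity.
Qed.

Lemma conv_shift_r f g m :
  l2 f -> l2 g -> conv f (fun k => g (k + m)%Z) = fun n => conv f g (n + m)%Z.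
Proof.
  intros; extensionality n; unfold conv.
  rewrite <- (sumZ_shift _ m (conv_summand f g (n + m) H H0)).
  f_equal; extensionality k; do 2 f_equal; lia.
Qed.

Lemma conv_shift_l f g m :
  l2 f -> l2 g -> conv (fun k => f (k + m)%Z) g = fun n => conv f g (n + m)%Z.
Proof.
  intros; extensionality n; unfold conv.
  f_equal; extensionality k; do 2 f_equal; lia.
Qed.

(* The coefficients of a product are inner products, so associativity is an
   instance of the adjoint formula. *)
Lemma conv_assoc a b f :
  ell1 a -> ell1 b -> l2 f -> conv a (conv b f) = conv (conv a b) f.
Proof.
  intros Ha Hb Hf; assert (Ha2 := ell1_l2 a Ha); assert (Hb2 := ell1_l2 b Hb).
  extensionality n.
  rewrite conv_as_ip by auto using l2_conv_ell1.
  rewrite ip_conv_adjoint by (auto; apply (l2_shift _ (- n)), l2_cstar, Ha2).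
  rewrite conv_as_ip by auto using l2_conv_ell1.
  f_equal.
  rewrite (conv_shift_r (cstar b) (cstar a) (- n)) by auto using l2_cstar.
  rewrite cstar_conv by assumption.
  rewrite (conv_comm (cstar a)) by auto using l2_cstar; reflexivity.
Qed.

(** * Hardy space, reproducing kernels and inner functions *)

Lemma H2_l2 f : H2 f -> l2 f.
Proof. intros [H _]; exact H. Qed.

Lemma H2_add f g : H2 f -> H2 g -> H2 (sadd f g).
Proof.
  intros [Hf Nf] [Hg Ng]; split; [apply l2_add; assumption |].
  intros n Hn; unfold sadd; rewrite Nf, Ng by exact Hn; ring.
Qed.

Lemma H2_scal c f : H2 f -> H2 (sscal c f).
Proof.
  intros [Hf Nf]; split; [apply l2_scal; assumption |].
  intros n Hn; unfold sscal; rewrite Nf by exact Hn; ring.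
Qed.

Lemma H2_sub f g : H2 f -> H2 g -> H2 (ssub f g).
Proof. intros; rewrite ssub_eq; apply H2_add, H2_scal; assumption. Qed.

Lemma H2_conv a f : ell1 a -> H2 a -> H2 f -> H2 (conv a f).
Proof.
  intros Ha [_ Na] [Hf Nf]; split; [apply l2_conv_ell1; assumption |].
  intros n Hn; unfold conv.
  replace (fun k => (a (n - k)%Z * f k)%Cx) with (fun _ : Z => C0); [apply sumZ_zero |].
  extensionality k; destruct (Z_lt_ge_dec k 0).
  - rewrite (Nf k) by lia; ring.
  - rewrite (Na (n - k)%Z) by lia; ring.
Qed.

(* Taylor coefficients of the Szegoe kernel [1 / (1 - conj(a) z)]. *)
Definition ker (a : Cx) : seqZ :=
  fun n => if Z_lt_dec n 0 then C0 else Cpow (Cconj a) (Z.to_nat n).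

Lemma Cmod_Cpow x n : Cmod (Cpow x n) = Cmod x ^ n.
Proof.
  induction n; simpl; [apply Cmod_C1 | rewrite Cmod_mul, IHn; reflexivity].
Qed.

Lemma Cpow_add x m n : Cpow x (m + n) = (Cpow x m * Cpow x n)%Cx.
Proof. induction m; simpl; [ring | rewrite IHm; ring]. Qed.

Lemma Cmod_lt1 a : Cnorm2 a < 1 -> Cmod a < 1.
Proof.
  rewrite <- Cmod_sqr; intros H; pose proof (Cmod_ge0 a).
  apply Rnot_le_lt; intros Hle; nra.
Qed.

Lemma ker_ell1 a : Cnorm2 a < 1 -> ell1 (ker a).
Proof.
  intros H; apply Cmod_lt1 in H; pose proof (Cmod_ge0 a) as H0.
  set (r := Cmod a) in *.
  exists (/ (1 - r)); intros N.
  assert (E : psumZR (fun n => Cmod (ker a n)) N = (1 - r ^ (S N)) / (1 - r)).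
  { induction N as [| N IH].
    - simpl; unfold ker; simpl; rewrite Cmod_C1; field; lra.
    - cbn [psumZR]; rewrite IH; unfold ker.
      destruct (Z_lt_dec (Z.of_nat (S N)) 0); [lia |].
      destruct (Z_lt_dec (- Z.of_nat (S N)) 0); [| lia].
      rewrite Nat2Z.id, Cmod_Cpow, Cmod_conj, Cmod_C0; fold r.
      simpl; field; lra. }
  rewrite E; unfold Rdiv; rewrite <- (Rmult_1_l (/ (1 - r))) at 2.
  apply Rmult_le_compat_r; [left; apply Rinv_0_lt_compat; lra |].
  pose proof (pow_le r (S N) H0); lra.
Qed.

Lemma ker_H2 a : Cnorm2 a < 1 -> H2 (ker a).
Proof.
  intros H; split; [apply ell1_l2, ker_ell1, H |].
  intros n Hn; unfold ker; destruct (Z_lt_dec n 0); [reflexivity | lia].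
Qed.

Lemma ker_l2 a : Cnorm2 a < 1 -> l2 (ker a).
Proof. intros; apply H2_l2, ker_H2; assumption. Qed.

Lemma ker_add a m n :
  (0 <= m)%Z -> (0 <= n)%Z -> ker a (m + n)%Z = (ker a m * ker a n)%Cx.
Proof.
  intros Hm Hn; unfold ker.
  destruct (Z_lt_dec (m + n) 0), (Z_lt_dec m 0), (Z_lt_dec n 0); try lia.
  rewrite Z2Nat.inj_add by assumption; apply Cpow_add.
Qed.

Lemma ker_0 a : ker a 0%Z = C1.
Proof. reflexivity. Qed.

Lemma ker_1 a : ker a 1%Z = Cconj a.
Proof. unfold ker; simpl; ring. Qed.

Lemma ker_neg a n : (n < 0)%Z -> ker a n = C0.
Proof. intros; unfold ker; destruct (Z_lt_dec n 0); [reflexivity | lia]. Qed.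

Lemma ker_succ a n : (0 <= n)%Z -> ker a (n + 1)%Z = (Cconj a * ker a n)%Cx.
Proof. intros; rewrite ker_add, ker_1 by lia; ring. Qed.

(** The coefficient form of [(1 - conj(a) z) k = 1]. *)
Lemma ker_shift_sub a :
  ssub (ker a) (sscal (Cconj a) (fun n => ker a (n + -1)%Z)) = delta0.
Proof.
  extensionality n; unfold ssub, sscal, delta0.
  destruct (Z.eqb_spec n 0) as [-> | Hn].
  - rewrite ker_0, ker_neg by lia; ring.
  - destruct (Z_lt_dec n 0).
    + rewrite !ker_neg by lia; ring.
    + replace n with ((n + -1) + 1)%Z at 1 by lia.
      rewrite ker_succ by lia; ring.
Qed.

(** That is, [b_a = (z - a) k]: computations with [bfactor] become shift relations for the
    kernel. *)
Lemma bfactor_ker a :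
  bfactor a = ssub (fun n => ker a (n + -1)%Z) (sscal a (ker a)).
Proof.
  assert (E : (1 - Cnorm2 a, 0) = (C1 - a * Cconj a)%Cx)
    by (rewrite Cmul_conj; apply Cx_ext; simpl; ring).
  extensionality n; unfold ssub, sscal.
  destruct n as [| p | p]; unfold bfactor.
  - rewrite ker_0, ker_neg by lia; ring.
  - replace (Z.pos p) with ((Z.pos p + -1) + 1)%Z at 2 by lia.
    rewrite ker_succ, E by lia; unfold ker.
    destruct (Z_lt_dec (Z.pos p + -1) 0); [lia |].
    replace (Z.to_nat (Z.pos p + -1)) with (Pos.to_nat p - 1)%nat by lia; ring.
  - rewrite !ker_neg by lia; ring.
Qed.

Lemma ell1_sadd f g : ell1 f -> ell1 g -> ell1 (sadd f g).
Proof. apply ell1_add. Qed.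

Lemma ell1_sscal c f : ell1 f -> ell1 (sscal c f).
Proof. apply ell1_scal. Qed.

Lemma bfactor_ell1 a : Cnorm2 a < 1 -> ell1 (bfactor a).
Proof.
  intros H; rewrite bfactor_ker, ssub_eq.
  apply ell1_sadd; [apply (ell1_shift _ (-1)) | do 2 apply ell1_sscal];
    apply ker_ell1, H.
Qed.

Lemma bfactor_H2 a : Cnorm2 a < 1 -> H2 (bfactor a).
Proof.
  intros H; split; [apply ell1_l2, bfactor_ell1, H |].
  intros n Hn; destruct n; [lia | lia | reflexivity].
Qed.

(** Inner functions in the convolution algebra. Summability makes multiplication by [th] and by
    conj(th) act on all of [l2], with associativity and adjoints available. *)
Definition inner1 (th : seqZ) : Prop :=
  ell1 th /\ H2 th /\ conv th (cstar th) = delta0.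

(* With [k = ker a] and [w = k k*], [(1 - conj a z) k = 1] gives [(1 - conj a z) w = k*]. *)
Lemma ker_star_recurrence a n :
  Cnorm2 a < 1 ->
  (conv (ker a) (cstar (ker a)) n - Cconj a * conv (ker a) (cstar (ker a)) (n + -1)%Z)%Cx
  = cstar (ker a) n.
Proof.
  intros Ha; assert (Hk := ker_l2 a Ha).
  assert (Hks : l2 (fun n => ker a (n + -1)%Z)) by (apply l2_shift, Hk).
  transitivity (conv delta0 (cstar (ker a)) n); [| rewrite conv_delta0_l; reflexivity].
  rewrite <- (ker_shift_sub a).
  rewrite (conv_comm (ssub _ _) (cstar (ker a))), conv_sub_r, conv_scal_r, conv_shift_r,
    (conv_comm (cstar (ker a)) (ker a)); auto using l2_cstar, l2_scal, l2_sub.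
Qed.

Lemma cstar_bfactor a :
  cstar (bfactor a)
  = ssub (fun n => cstar (ker a) (n + 1)%Z) (sscal (Cconj a) (cstar (ker a))).
Proof.
  rewrite bfactor_ker; extensionality n; unfold cstar, ssub, sscal.
  rewrite Cconj_add, Cconj_opp, Cconj_mul; do 4 f_equal; lia.
Qed.

Lemma cstar_delta0 : cstar delta0 = delta0.
Proof.
  extensionality n; unfold cstar, delta0.
  destruct (Z.eqb_spec (- n) 0), (Z.eqb_spec n 0); try lia;
    [apply Cconj_1 | apply Cconj_0].
Qed.

(** With [w = k conj(k)] the product is [(z - a)(1/z - conj(a)) w]. The recurrence turns
    [(1/z - conj(a)) w] into [conj(k) / z], and [(1 - a/z) conj(k) = 1] is the conjugate of
    [ker_shift_sub]. *)
Lemma bfactor_inner1 a : Cnorm2 a < 1 -> inner1 (bfactor a).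
Proof.
  intros Ha.
  split; [apply bfactor_ell1, Ha |]; split; [apply bfactor_H2, Ha |].
  assert (Hk := ker_l2 a Ha).
  assert (Hks : l2 (fun n => ker a (n + -1)%Z)) by (apply l2_shift, Hk).
  assert (Hsk : l2 (fun n => cstar (ker a) (n + 1)%Z)) by (apply l2_shift, l2_cstar, Hk).
  rewrite cstar_bfactor, bfactor_ker.
  rewrite conv_sub_r, conv_scal_r, conv_shift_r; auto using l2_cstar, l2_scal, l2_sub.
  rewrite (conv_comm _ (cstar (ker a))), conv_sub_r, conv_scal_r, conv_shift_r,
      (conv_comm (cstar (ker a)) (ker a)); auto using l2_cstar, l2_scal, l2_sub.
  assert (Ed : forall n, (cstar (ker a) n - a * cstar (ker a) (n + 1)%Z)%Cx = delta0 n).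
  { intros n; rewrite <- cstar_delta0, <- (ker_shift_sub a).
    unfold cstar, ssub, sscal.
    rewrite Cconj_add, Cconj_opp, Cconj_mul, Cconj_conj.
    replace (- (n + 1))%Z with (- n + -1)%Z by lia; reflexivity. }
  extensionality n; unfold ssub, sscal.
  rewrite <- Ed, <- (ker_star_recurrence a n), <- (ker_star_recurrence a (n + 1)) by exact Ha.
  replace (n + 1 + -1)%Z with n by lia; ring.
Qed.

Lemma inner1_delta0 : inner1 delta0.
Proof.
  split; [apply ell1_delta0 |]; split.
  - split; [apply ell1_l2, ell1_delta0 |].
    intros n Hn; unfold delta0; destruct (Z.eqb_spec n 0); [lia | reflexivity].
  - rewrite conv_delta0_l; apply cstar_delta0.
Qed.

Section InnerFunctions.

Variable th : seqZ.
Hypothesis Hth : inner1 th.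

Lemma inner1_ell1 : ell1 th. Proof. apply Hth. Qed.
Lemma inner1_H2 : H2 th. Proof. apply Hth. Qed.
Lemma inner1_l2 : l2 th. Proof. apply H2_l2, inner1_H2. Qed.
Lemma inner1_star_ell1 : ell1 (cstar th). Proof. apply ell1_cstar, inner1_ell1. Qed.

Local Hint Resolve inner1_ell1 inner1_H2 inner1_l2 inner1_star_ell1 l2_conv_ell1 l2_cstar : core.

Lemma inner1_cancel f : l2 f -> conv th (conv (cstar th) f) = f.
Proof.
  intros Hf; rewrite conv_assoc by auto.
  destruct Hth as [_ [_ ->]]; apply conv_delta0_l.
Qed.

Lemma inner1_cancel_star f : l2 f -> conv (cstar th) (conv th f) = f.
Proof.
  intros Hf; rewrite conv_assoc by auto.
  rewrite (conv_comm (cstar th) th) by auto; destruct Hth as [_ [_ ->]]; apply conv_delta0_l.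
Qed.

Lemma ip_mul_inner1 f g : l2 f -> l2 g -> ip (conv th f) (conv th g) = ip f g.
Proof.
  intros; rewrite ip_conv_adjoint, inner1_cancel_star by auto; reflexivity.
Qed.

Lemma inner1_conv b : inner1 b -> inner1 (conv th b).
Proof.
  intros Hb; assert (Hb' := Hb); destruct Hb' as [H1 [H2 H3]].
  split; [apply ell1_conv; auto |]; split; [apply H2_conv; auto |].
  rewrite cstar_conv, (conv_comm (cstar th)) by auto using ell1_l2.
  rewrite <- conv_assoc by auto using ell1_l2, ell1_cstar.
  rewrite (conv_assoc b), H3, conv_delta0_l by auto using ell1_cstar.
  apply Hth.
Qed.

Lemma inner1_unimodular c : Cnorm2 c = 1 -> inner1 (sscal c th).
Proof.
  intros Hc; split; [apply ell1_sscal; auto |]; split; [apply H2_scal; auto |].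
  replace (cstar (sscal c th)) with (sscal (Cconj c) (cstar th))
    by (extensionality n; unfold cstar, sscal; rewrite Cconj_mul; reflexivity).
  rewrite conv_scal_l, conv_scal_r by auto using l2_scal.
  destruct Hth as [_ [_ ->]].
  extensionality n; unfold sscal.
  transitivity (c * Cconj c * delta0 n)%Cx; [ring |].
  rewrite Cmul_conj, Hc; apply Cx_ext; simpl; ring.
Qed.

(** * Model spaces *)

(** Moving [th] across the inner product turns orthogonality to [th H^2] into orthogonality of
    [conj(th) f] to H^2; the shifts of [delta0], that is the powers of [z], are the test functions.
    Membership thereby becomes a condition on single coefficients. *)
Lemma K2_iff f :
  K2 th f <-> H2 f /\ forall n, (0 <= n)%Z -> conv (cstar th) f n = C0.
Proof.
  split; intros [Hf H]; split; try exact Hf; assert (Hl := H2_l2 f Hf).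
  - intros n Hn.
    assert (Hd : forall k, k <> n -> delta0 (k + - n)%Z = C0)
      by (intros k Hk; unfold delta0; destruct (Z.eqb_spec (k + - n) 0); [lia | reflexivity]).
    assert (H2d : H2 (fun k => delta0 (k + - n)%Z)).
    { split; [apply l2_shift, ell1_l2, ell1_delta0 |]; intros; apply Hd; lia. }
    rewrite <- (H _ H2d).
    rewrite <- ip_conv_adjoint_star by auto using H2_l2.
    symmetry; apply (ell1_single _ n).
    + rewrite Z.add_opp_diag_r; unfold delta0; simpl; rewrite Cconj_1; ring.
    + intros k Hk; rewrite Hd, Cconj_0 by exact Hk; ring.
  - intros h Hh; rewrite <- ip_conv_adjoint_star by auto using H2_l2.
    apply ip_zero; intros n.
    destruct (Z_lt_ge_dec n 0); [right; apply Hh; lia | left; apply H; lia].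
Qed.

Lemma K2_H2 f : K2 th f -> H2 f.
Proof. intros [H _]; exact H. Qed.

Lemma K2_l2 f : K2 th f -> l2 f.
Proof. intros H; apply H2_l2, K2_H2, H. Qed.

Lemma K2_add f g : K2 th f -> K2 th g -> K2 th (sadd f g).
Proof.
  intros [Hf Of] [Hg Og]; split; [apply H2_add; assumption |].
  intros h Hh; rewrite ip_add_l, Of, Og by auto using H2_l2; ring.
Qed.

Lemma K2_scal c f : K2 th f -> K2 th (sscal c f).
Proof.
  intros [Hf Of]; split; [apply H2_scal; assumption |].
  intros h Hh; rewrite ip_scal_l, Of by auto using H2_l2; ring.
Qed.

Lemma K2_sub f g : K2 th f -> K2 th g -> K2 th (ssub f g).
Proof. intros; rewrite ssub_eq; apply K2_add, K2_scal; assumption. Qed.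

(* Boundary values of [conj(z f)], so that [Cop th f = th * Jop f]. *)
Definition Jop (f : seqZ) : seqZ := fun n => Cconj (f (- n - 1)%Z).

Lemma Jop_eq f : Jop f = fun n => Cconj (f (-1 - n)%Z).
Proof. extensionality n; unfold Jop; do 2 f_equal; lia. Qed.

Lemma l2_Jop f : l2 f -> l2 (Jop f).
Proof. rewrite Jop_eq; apply l2_conj_reflect. Qed.

Lemma Jop_Jop f : Jop (Jop f) = f.
Proof.
  extensionality n; unfold Jop; rewrite Cconj_conj; f_equal; lia.
Qed.

Lemma ip_Jop f g : l2 f -> l2 g -> ip (Jop f) (Jop g) = ip g f.
Proof. rewrite !Jop_eq; apply ip_conj_shift. Qed.

Lemma Jop_conv u f : l2 u -> l2 f -> Jop (conv u f) = conv (cstar u) (Jop f).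
Proof.
  intros Hu Hf; extensionality n; unfold Jop at 1, conv.
  rewrite <- sumZ_conj by (apply conv_summand; assumption).
  rewrite <- (sumZ_reflect _ (-1)) by (apply ell1_conj, conv_summand; assumption).
  f_equal; extensionality k; rewrite Cconj_mul; unfold cstar, Jop.
  do 3 f_equal; lia.
Qed.

Lemma Cop_Jop f : Cop th f = conv th (Jop f).
Proof. reflexivity. Qed.

Local Hint Resolve l2_Jop K2_l2 : core.

Lemma l2_Cop f : l2 f -> l2 (Cop th f).
Proof. intros; rewrite Cop_Jop; auto. Qed.

Lemma Jop_Cop f : l2 f -> Jop (Cop th f) = conv (cstar th) f.
Proof. intros; rewrite Cop_Jop, Jop_conv, Jop_Jop by auto; reflexivity. Qed.

Lemma Cop_Cop f : l2 f -> Cop th (Cop th f) = f.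
Proof.
  intros; rewrite (Cop_Jop (Cop th f)), Jop_Cop by auto; apply inner1_cancel; auto.
Qed.

Lemma ip_Cop f g : l2 f -> l2 g -> ip (Cop th f) (Cop th g) = ip g f.
Proof.
  intros; rewrite !Cop_Jop, ip_mul_inner1, ip_Jop by auto; reflexivity.
Qed.

(** [Jop] swaps negative and nonnegative indices, so the two conditions of [K2_iff] change
    places. *)
Lemma K2_Cop f : K2 th f -> K2 th (Cop th f).
Proof.
  intros H; assert (Hl := K2_l2 f H); apply K2_iff in H; destruct H as [[_ Nf] H].
  apply K2_iff; split; [split; [apply l2_Cop, Hl |] |]; intros n Hn.
  - rewrite <- (Jop_Jop (Cop th f)), Jop_Cop by exact Hl.
    unfold Jop; rewrite H by lia; apply Cconj_0.
  - rewrite Cop_Jop, inner1_cancel_star by auto; unfold Jop.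
    rewrite Nf by lia; apply Cconj_0.
Qed.

(** The Riesz projection of L^2 onto H^2. *)
Definition posproj (g : seqZ) : seqZ := fun n => if Z_lt_dec n 0 then C0 else g n.

Lemma posproj_H2 g : l2 g -> H2 (posproj g).
Proof.
  intros Hg; split.
  - apply (l2_le _ g); [| exact Hg]; intros n; unfold posproj.
    destruct (Z_lt_dec n 0); [| lra].
    pose proof (Cnorm2_ge0 (g n)); unfold Cnorm2 in *; simpl; lra.
  - intros n Hn; unfold posproj; destruct (Z_lt_dec n 0); [reflexivity | lia].
Qed.

Lemma ip_posproj g h : l2 g -> H2 h -> ip (posproj g) h = ip g h.
Proof.
  intros Hg [_ Nh]; unfold ip; f_equal; extensionality n; unfold posproj.
  destruct (Z_lt_dec n 0); [rewrite Nh, Cconj_0 by assumption; ring | reflexivity].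
Qed.

(** The epsilon in [Pth] is meaningful only once a projection exists. With [Q] the Riesz projection
    and [q = Q g], the explicit candidate is [q - th Q(conj(th) q)], so no completeness argument is
    involved. *)
Lemma Pth_spec g :
  l2 g -> K2 th (Pth th g) /\ forall k, K2 th k -> ip (Pth th g) k = ip g k.
Proof.
  intros Hg.
  assert (Hex : exists p, K2 th p /\ forall k, K2 th k -> ip (ssub g p) k = C0).
  { set (q := posproj g); assert (Hq : H2 q) by (apply posproj_H2, Hg).
    set (r := posproj (conv (cstar th) q)).
    assert (Hr : H2 r) by (apply posproj_H2; auto using H2_l2).
    assert (Htr : H2 (conv th r)) by (apply H2_conv; auto).
    exists (ssub q (conv th r)); split.
    - apply K2_iff; split; [apply H2_sub; assumption |].
      intros n Hn; rewrite conv_sub_r, inner1_cancel_star by auto using H2_l2.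
      unfold ssub, r, posproj; destruct (Z_lt_dec n 0); [lia | ring].
    - intros k [Hk Ok].
      rewrite !ip_sub_l by auto using H2_l2, l2_sub.
      rewrite (ip_conj k (conv th r)), Ok by auto using H2_l2.
      unfold q; rewrite ip_posproj, Cconj_0 by assumption; ring. }
  apply (epsilon_spec (inhabits szero)) in Hex; fold (Pth th g) in Hex.
  destruct Hex as [H1 H2]; split; [exact H1 |]; intros k Hk.
  specialize (H2 k Hk); rewrite ip_sub_l in H2 by auto.
  replace (ip (Pth th g) k) with (ip g k - (ip g k - ip (Pth th g) k))%Cx by ring.
  rewrite H2; ring.
Qed.

Lemma Pth_unique g p :
  l2 g -> K2 th p -> (forall k, K2 th k -> ip p k = ip g k) -> Pth th g = p.
Proof.
  intros Hg Hp H; destruct (Pth_spec g Hg) as [H1 H2].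
  assert (Hs := K2_sub _ _ H1 Hp).
  apply ssub_zero, ip_self_eq0; [auto |].
  rewrite ip_sub_l, H, H2 by auto; ring.
Qed.

(** Pythagoras: the squared norm of [g - Pth th g] is the difference of the two sides. *)
Lemma nsq_Pth_le g : l2 g -> nsq (Pth th g) <= nsq g.
Proof.
  intros Hg; destruct (Pth_spec g Hg) as [H1 H2].
  assert (Hp := K2_l2 _ H1).
  assert (Hs : l2 (ssub g (Pth th g))) by (apply l2_sub; assumption).
  assert (E : ip (ssub g (Pth th g)) (ssub g (Pth th g))
              = (ip g g - ip (Pth th g) (Pth th g))%Cx).
  { rewrite ip_sub_l by assumption.
    rewrite (ip_conj _ g), (ip_conj _ (Pth th g)) by assumption.
    rewrite !ip_sub_l, (H2 _ H1) by assumption.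
    rewrite (ip_conj g (Pth th g)) by assumption.
    rewrite <- (H2 _ H1), (ip_self g), (ip_self (Pth th g)) by assumption.
    apply Cx_ext; simpl; ring. }
  rewrite !ip_self in E by assumption; injection E as E.
  pose proof (nsq_energy _ Hs O) as H0; simpl in H0.
  pose proof (Cnorm2_ge0 (ssub g (Pth th g) 0%Z)); lra.
Qed.

End InnerFunctions.

(** * Point evaluation and division by a Blaschke factor *)

Lemma ip_shift_ker a f :
  Cnorm2 a < 1 -> H2 f -> ip (fun n => f (n + -1)%Z) (ker a) = (a * ip f (ker a))%Cx.
Proof.
  intros Ha Hf; assert (Hk := ker_l2 a Ha); assert (Hl := H2_l2 f Hf).
  unfold ip; rewrite <- (sumZ_shift _ 1) by (apply ip_summand; [apply l2_shift |]; assumption).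
  rewrite <- sumZ_scal by (apply ip_summand; assumption).
  f_equal; extensionality n; replace (n + 1 + -1)%Z with n by lia.
  destruct (Z_lt_ge_dec n 0).
  - destruct Hf as [_ Nf]; rewrite Nf by assumption; ring.
  - rewrite ker_succ, Cconj_mul, Cconj_conj by lia; ring.
Qed.

Lemma ip_delta0_ker a : ip delta0 (ker a) = C1.
Proof.
  apply (ell1_single _ 0%Z).
  - rewrite ker_0, Cconj_1; unfold delta0; simpl; ring.
  - intros n Hn; unfold delta0; destruct (Z.eqb_spec n 0); [lia | ring].
Qed.

(** Evaluation of [(1 - conj(b) z) k_b = 1] at [a]. The product form yields non-vanishing of the
    kernel without a prior division. *)
Lemma ip_ker_ker a b :
  Cnorm2 a < 1 -> Cnorm2 b < 1 ->
  ((C1 - Cconj b * a) * ip (ker b) (ker a))%Cx = C1.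
Proof.
  intros Ha Hb.
  assert (Hka := ker_l2 a Ha); assert (Hkb := ker_l2 b Hb).
  assert (Hs := l2_shift (ker b) (-1) Hkb).
  transitivity (ip delta0 (ker a)); [| apply ip_delta0_ker].
  rewrite <- (ker_shift_sub b).
  rewrite ip_sub_l, ip_scal_l, ip_shift_ker by auto using l2_scal, ker_H2.
  ring.
Qed.

Lemma ip_ker_ker_neq0 a b :
  Cnorm2 a < 1 -> Cnorm2 b < 1 -> ip (ker b) (ker a) <> C0.
Proof.
  intros Ha Hb E; assert (H := ip_ker_ker a b Ha Hb); rewrite E in H.
  assert (H0 : C0 = C1) by (rewrite <- H; ring).
  injection H0; lra.
Qed.

Lemma ip_bfactor_ker a b :
  Cnorm2 a < 1 -> Cnorm2 b < 1 ->
  ip (bfactor b) (ker a) = ((a - b) * ip (ker b) (ker a))%Cx.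
Proof.
  intros Ha Hb; assert (Hka := ker_l2 a Ha); assert (Hkb := ker_l2 b Hb).
  assert (Hs := l2_shift (ker b) (-1) Hkb).
  rewrite bfactor_ker, ip_sub_l, ip_scal_l, ip_shift_ker
    by auto using l2_scal, ker_H2.
  ring.
Qed.

(* [ip f (ker a)] is the value of [f] at [a]. *)
Lemma ip_conv_ker b f a :
  Cnorm2 a < 1 -> ell1 b -> H2 b -> H2 f ->
  ip (conv b f) (ker a) = (ip b (ker a) * ip f (ker a))%Cx.
Proof.
  intros Ha Hb [Hb2 Nb] [Hf Nf]; assert (Hk := ker_l2 a Ha).
  rewrite ip_conv_adjoint by assumption.
  (* The kernel is an eigenvector of the adjoint of multiplication by [b]: the analytic part of
     [conj(b) k] is [conj(b(a)) k]. *)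
  assert (E : forall n, (0 <= n)%Z ->
            conv (cstar b) (ker a) n = (ker a n * Cconj (ip b (ker a)))%Cx).
  { intros n Hn; unfold conv, ip.
    rewrite <- (sumZ_shift _ n) by (apply conv_summand; auto using l2_cstar).
    rewrite <- sumZ_conj, <- sumZ_scal by (try apply ell1_conj; apply ip_summand; assumption).
    f_equal; extensionality k; unfold cstar.
    replace (- (n - (k + n)))%Z with k by lia.
    destruct (Z_lt_ge_dec k 0).
    - rewrite Nb by assumption; rewrite Cconj_mul, Cconj_0; ring.
    - rewrite ker_add, Cconj_mul, Cconj_conj by lia; ring. }
  unfold ip at 1 3; rewrite <- sumZ_scal by (apply ip_summand; assumption).
  f_equal; extensionality n; destruct (Z_lt_ge_dec n 0).
  - rewrite Nf by assumption; ring.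
  - rewrite E, Cconj_mul, Cconj_conj by lia; ring.
Qed.

Lemma bfactor_succ a m :
  (0 <= m)%Z -> bfactor a (m + 1)%Z = ((C1 - a * Cconj a) * ker a m)%Cx.
Proof.
  intros Hm; rewrite bfactor_ker; unfold ssub, sscal.
  replace (m + 1 + -1)%Z with m by lia; rewrite ker_succ by exact Hm; ring.
Qed.

(** From index 1 on the Taylor coefficients of [b_a] are geometric, so every negative coefficient of
    [conj(b_a) h] is a multiple of [h(a)]. *)
Lemma H2_divide a h :
  Cnorm2 a < 1 -> H2 h -> ip h (ker a) = C0 -> H2 (conv (cstar (bfactor a)) h).
Proof.
  intros Ha [Hh Nh] E; assert (Hk := ker_l2 a Ha); split.
  - apply l2_conv_ell1; [apply ell1_cstar, bfactor_ell1, Ha | exact Hh].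
  - intros n Hn; unfold conv.
    transitivity (Cconj ((C1 - a * Cconj a) * ker a (- n - 1)%Z) * ip h (ker a))%Cx;
      [| rewrite E; ring].
    unfold ip; rewrite <- sumZ_scal by (apply ip_summand; assumption).
    f_equal; extensionality k; destruct (Z_lt_ge_dec k 0).
    + rewrite Nh by assumption; ring.
    + unfold cstar; replace (- (n - k))%Z with ((k + (- n - 1)) + 1)%Z by lia.
      rewrite bfactor_succ, ker_add, !Cconj_mul by lia; ring.
Qed.

(** The choice [c = h(a) / k(a)] makes [h - c k] vanish at [a], hence divisible by the Blaschke
    factor. Inductions on the zeros descend through this splitting. *)
Lemma H2_decompose a h :
  Cnorm2 a < 1 -> H2 h ->
  exists c, H2 (conv (cstar (bfactor a)) (ssub h (sscal c (ker a)))) /\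
    h = sadd (sscal c (ker a))
             (conv (bfactor a) (conv (cstar (bfactor a)) (ssub h (sscal c (ker a))))).
Proof.
  intros Ha Hh; assert (Hk := ker_H2 a Ha).
  exists (ip h (ker a) / ip (ker a) (ker a))%Cx; split.
  - apply H2_divide; [exact Ha | apply H2_sub, H2_scal; assumption |].
    rewrite ip_sub_l, ip_scal_l by auto using H2_l2, l2_scal.
    field; apply ip_ker_ker_neq0; exact Ha.
  - rewrite inner1_cancel
      by (auto using bfactor_inner1; apply l2_sub; auto using H2_l2, l2_scal).
    extensionality n; unfold sadd, ssub; ring.
Qed.

(** If [th] vanishes at [a], so does every [th h], and vanishing at [a] means orthogonality to the
    kernel. *)
Lemma K2_ker th a :
  Cnorm2 a < 1 -> inner1 th -> ip th (ker a) = C0 -> K2 th (ker a).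
Proof.
  intros Ha Hth E; split; [apply ker_H2, Ha |]; intros h Hh.
  destruct Hth as [H1 [H2 _]].
  rewrite (ip_conj (conv th h)) by auto using l2_conv_ell1, H2_l2, ker_l2.
  rewrite ip_conv_ker, E by assumption.
  rewrite Cconj_mul, Cconj_0; ring.
Qed.

(** The kernel is fixed by the conjugation of its own factor:
    [conj(b_a) k = (1/z - conj(a)) conj(k) k], which the recurrence reduces to
    [conj(k) / z = conj(z k)]. *)
Lemma Cop_bfactor_ker a : Cnorm2 a < 1 -> conv (bfactor a) (Jop (ker a)) = ker a.
Proof.
  intros Ha; assert (Hk := ker_l2 a Ha).
  rewrite <- (inner1_cancel (bfactor a) (bfactor_inner1 a Ha) (ker a) Hk) at 2.
  f_equal; rewrite cstar_bfactor.
  assert (Hs : l2 (cstar (ker a))) by (apply l2_cstar, Hk).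
  assert (Hs1 := l2_shift _ 1 Hs).
  rewrite (conv_comm _ (ker a)), conv_sub_r, conv_scal_r, conv_shift_r;
    auto using l2_sub, l2_scal.
  extensionality n; unfold ssub, sscal.
  transitivity (cstar (ker a) (n + 1)%Z).
  - unfold Jop, cstar; do 2 f_equal; lia.
  - rewrite <- ker_star_recurrence by exact Ha.
    replace (n + 1 + -1)%Z with n by lia; ring.
Qed.

(** Since [phi] is only square summable, the adjoint formula is applied to the summable factors
    instead. Both sides become inner products of [phi] with a function, and these functions agree
    because [conj(C f) C g = conj(g) f]. *)
Lemma conv_symbol_Cop th phi f g :
  inner1 th -> l2 phi -> ell1 f -> ell1 g ->
  ip (conv phi (Cop th f)) (Cop th g) = ip (conv phi g) f.
Proof.
  intros Hth Hphi Hf Hg.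
  assert (Hf2 := ell1_l2 f Hf); assert (Hg2 := ell1_l2 g Hg).
  assert (Ht := inner1_ell1 th Hth); assert (Ht2 := ell1_l2 th Ht).
  assert (HJf : ell1 (Jop f)) by (rewrite Jop_eq; apply ell1_conj, ell1_reflect, Hf).
  assert (HJf2 := ell1_l2 _ HJf); assert (HJg2 := l2_Jop g Hg2).
  assert (HCf : ell1 (Cop th f)) by (apply ell1_conv; assumption).
  rewrite (conv_comm phi), ip_conv_adjoint by auto using ell1_l2, l2_Cop.
  rewrite (conv_comm phi), ip_conv_adjoint by assumption.
  f_equal; rewrite !Cop_Jop, cstar_conv, (conv_comm (cstar th)) by auto using l2_cstar.
  rewrite <- conv_assoc by auto using ell1_cstar, l2_conv_ell1.
  rewrite inner1_cancel_star by assumption.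
  (* These are [conj(conj(z f)) = z f] and [conj(z g) = conj(g) / z]; the two opposite shifts
     cancel. *)
  assert (E1 : cstar (Jop f) = fun n => f (n + -1)%Z).
  { extensionality n; unfold cstar, Jop; rewrite Cconj_conj; f_equal; lia. }
  assert (E2 : Jop g = fun n => cstar g (n + 1)%Z).
  { extensionality n; unfold cstar, Jop; do 2 f_equal; lia. }
  assert (Hs := l2_shift _ 1 (l2_cstar g Hg2)).
  rewrite E1, E2, conv_shift_l, conv_shift_r, (conv_comm f) by auto using l2_cstar.
  extensionality n; f_equal; lia.
Qed.

(** * Operators with a symbol *)

(** The conjugation is antilinear, so for linear [A] the form [<A f, C g>] is bilinear and
    C-symmetry becomes its ordinary symmetry. No projection occurs in it. *)
Definition bilinear_symmetric (th : seqZ) (A : seqZ -> seqZ) : Prop :=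
  forall f g, K2 th f -> K2 th g -> ip (A f) (Cop th g) = ip (A g) (Cop th f).

(** [C] is an antiunitary involution of [K_th], so substituting [C f] for [f] translates one
    condition into the other. The projection is tested only against elements of [K_th], where it
    drops out. *)
Lemma Csymmetric_compress th A :
  inner1 th -> (forall f, K2 th f -> l2 (A f)) ->
  Csymmetric th (compress th A) <-> bilinear_symmetric th A.
Proof.
  intros Hth HA.
  assert (E : forall f g, K2 th f -> K2 th g ->
    ip (Cop th (compress th A f)) g = Cconj (ip (A f) (Cop th g)) /\
    ip (Cop th f) (compress th A g) = Cconj (ip (A g) (Cop th f))).
  { intros f g Hf Hg.
    destruct (Pth_spec th Hth (A f) (HA f Hf)) as [H1 H2].
    destruct (Pth_spec th Hth (A g) (HA g Hg)) as [H3 H4].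
    assert (HCf := K2_Cop th Hth f Hf); assert (HCg := K2_Cop th Hth g Hg).
    unfold compress; split.
    - rewrite <- (Cop_Cop th Hth g) at 1 by (eapply K2_l2, Hg).
      rewrite ip_Cop by (eauto using K2_l2).
      rewrite <- H2 by exact HCg; apply ip_conj; eauto using K2_l2.
    - rewrite <- H4 by exact HCf; apply ip_conj; eauto using K2_l2. }
  split; intros H f g Hf Hg.
  - destruct (E f g Hf Hg) as [E1 E2].
    assert (H0 := H _ _ (K2_Cop th Hth f Hf) Hg).
    rewrite (Cop_Cop th Hth f), E1, E2 in H0 by (eapply K2_l2, Hf).
    rewrite <- (Cconj_conj (ip (A f) _)), H0, Cconj_conj; reflexivity.
  - assert (HCf := K2_Cop th Hth f Hf).
    rewrite (proj1 (E _ _ HCf Hg)), (H _ _ HCf Hg), <- (proj2 (E _ _ HCf Hg)).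
    rewrite Cop_Cop by (auto; eapply K2_l2, Hf); reflexivity.
Qed.

(** The comparison of [A] with [phi] is made only as forms on [K_th], so values of [A] may leave
    that space; [defect_symmetric] applies this to multiplication by [phi] itself. *)
Lemma symbol_symmetric th A phi :
  inner1 th -> l2 phi -> (forall f, K2 th f -> ell1 f) ->
  (forall f g, K2 th f -> K2 th g -> ip (A f) g = ip (conv phi f) g) ->
  bilinear_symmetric th A.
Proof.
  intros Hth Hphi Hl1 HA f g Hf Hg.
  assert (HCf := K2_Cop th Hth f Hf); assert (HCg := K2_Cop th Hth g Hg).
  rewrite !HA by assumption.
  rewrite <- (Cop_Cop th Hth f) at 1 by (eapply K2_l2, Hf).
  apply conv_symbol_Cop; auto.
Qed.

Lemma K2_conv al w f :
  ell1 al -> ell1 w -> H2 w -> K2 al f -> K2 (conv al w) f.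
Proof.
  intros Hal Hw Hw2 [Hf Of]; split; [exact Hf |]; intros h Hh.
  rewrite <- conv_assoc by auto using H2_l2.
  apply Of, H2_conv; assumption.
Qed.

(** * Extending a symbol by one zero *)

Section OneZeroMore.

Variables (th' : seqZ) (a : Cx) (A : seqZ -> seqZ).
Let th := conv (bfactor a) th'.
Let k := ker a.
(** The conjugate kernel [C k] (see [Hek]). It is orthogonal to [K_th'], so pairing with [e] reads
    off the component along [k]. *)
Let e := conv th' k.

Hypothesis Ha : Cnorm2 a < 1.
Hypothesis Hth' : inner1 th'.
Hypothesis Hnz : ip th' k <> C0.
Hypothesis Hl1 : forall f, K2 th f -> ell1 f.
Hypothesis HA : forall f, K2 th f -> l2 (A f).
Hypothesis Hadd : forall f g, K2 th f -> K2 th g -> A (sadd f g) = sadd (A f) (A g).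
Hypothesis Hscal : forall c f, K2 th f -> A (sscal c f) = sscal c (A f).
Hypothesis Hsym : bilinear_symmetric th A.

Let Hb : inner1 (bfactor a). Proof. apply bfactor_inner1, Ha. Qed.
Let Hbl : ell1 (bfactor a). Proof. apply bfactor_ell1, Ha. Qed.
Let Hbl2 : l2 (bfactor a). Proof. apply ell1_l2, Hbl. Qed.
Let Htl : ell1 th'. Proof. apply inner1_ell1, Hth'. Qed.
Let Htl2 : l2 th'. Proof. apply ell1_l2, Htl. Qed.
Let Hth : inner1 th. Proof. apply inner1_conv; assumption. Qed.
Let Hk2 : H2 k. Proof. apply ker_H2, Ha. Qed.
Let Hkl : l2 k. Proof. apply H2_l2, Hk2. Qed.
Let He2 : H2 e.
Proof. apply H2_conv; [apply inner1_ell1 | apply inner1_H2 |]; assumption. Qed.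
Let Hel : l2 e. Proof. apply H2_l2, He2. Qed.

Let Hk : K2 th k.
Proof.
  apply K2_ker; [exact Ha | exact Hth |]; unfold th, k.
  rewrite ip_conv_ker
    by (auto using bfactor_ell1, bfactor_H2; apply inner1_H2, Hth').
  rewrite ip_bfactor_ker by exact Ha; ring.
Qed.

Let Hsub : forall f, K2 th' f -> K2 th f.
Proof.
  intros f Hf; unfold th; rewrite conv_comm by assumption.
  apply K2_conv; auto using bfactor_H2.
Qed.

Let Hek : Cop th k = e.
Proof.
  rewrite Cop_Jop; unfold th, k, e.
  rewrite (conv_comm (bfactor a)), <- conv_assoc by auto using l2_Jop.
  rewrite Cop_bfactor_ker by exact Ha; reflexivity.
Qed.

(** Up to conjugation this number is [e(a) = th'(a) k(a)]. *)
Let Hke : ip k e <> C0.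
Proof.
  rewrite (ip_conj e k) by assumption; apply Cconj_neq0.
  unfold e, k; rewrite ip_conv_ker by auto using inner1_H2.
  apply Cmul_neq0; [exact Hnz | apply ip_ker_ker_neq0; exact Ha].
Qed.

(** Writing [h = c k + b_a h'] gives [th' h = c e + th h']. So an element of [K_th] lies in [K_th']
    as soon as it is orthogonal to [e], which the subtracted multiple of [k] achieves. *)
Lemma K2_split f :
  K2 th f -> K2 th' (ssub f (sscal (ip f e / ip k e)%Cx k)).
Proof.
  intros Hf; set (r := ssub f _).
  assert (Hr : K2 th r) by (apply K2_sub, K2_scal; assumption).
  assert (Hfl := K2_l2 th f Hf); assert (Hrl := K2_l2 th r Hr).
  split; [apply (K2_H2 th), Hr |]; intros h Hh.
  destruct (H2_decompose a h Ha Hh) as [c [Hh' ->]].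
  set (h' := conv (cstar (bfactor a)) _) in *; fold k.
  rewrite conv_add_r, conv_scal_r, conv_assoc, (conv_comm th' (bfactor a))
    by auto using l2_scal, H2_l2, ell1_l2, l2_conv_ell1.
  fold th e.
  assert (Hthh : l2 (conv th h'))
    by (apply l2_conv_ell1; [apply inner1_ell1, Hth | apply H2_l2, Hh']).
  rewrite ip_add_r, ip_scal_r by auto using l2_scal.
  destruct Hr as [_ Or]; rewrite Or by exact Hh'.
  unfold r; rewrite ip_sub_l, ip_scal_l by auto using l2_scal.
  field; exact Hke.
Qed.

Definition defect (phi f : seqZ) : seqZ := ssub (A f) (conv phi f).

Lemma l2_defect phi f : ell1 phi -> K2 th f -> l2 (defect phi f).
Proof.
  intros Hp Hf; apply l2_sub; [apply HA, Hf |].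
  apply l2_conv_ell1; [exact Hp | apply (K2_l2 th), Hf].
Qed.

Lemma ip_defect_add phi psi f g :
  ell1 phi -> ell1 psi -> K2 th f -> l2 g ->
  ip (defect (sadd phi psi) f) g = (ip (defect phi f) g - ip (conv psi f) g)%Cx.
Proof.
  intros Hp Hq Hf Hg; unfold defect; assert (Hfl := K2_l2 th f Hf).
  rewrite conv_add_l, !ip_sub_l, ip_add_l
    by auto using ell1_l2, l2_conv_ell1, l2_add; ring.
Qed.

Lemma ip_defect_split phi f g :
  ell1 phi -> K2 th f -> l2 g ->
  ip (defect phi f) g =
    (ip f e / ip k e * ip (defect phi k) g
     + ip (defect phi (ssub f (sscal (ip f e / ip k e)%Cx k))) g)%Cx.
Proof.
  intros Hp Hf Hg; set (c := (ip f e / ip k e)%Cx).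
  assert (Hr := Hsub _ (K2_split f Hf)); fold c in Hr.
  assert (Hck := K2_scal th Hth c k Hk).
  assert (E : f = sadd (sscal c k) (ssub f (sscal c k)))
    by (extensionality n; unfold sadd, ssub; ring).
  rewrite E at 1; unfold defect.
  assert (Hrl := K2_l2 th _ Hr); assert (Hckl := l2_scal c k Hkl).
  assert (HAr := HA _ Hr); assert (HAk := HA _ Hk).
  set (r := ssub f (sscal c k)) in *; clearbody r.
  rewrite Hadd, Hscal, conv_add_r, conv_scal_r by auto using ell1_l2.
  rewrite !ip_sub_l, !ip_add_l, !ip_scal_l
    by auto using l2_conv_ell1, l2_scal, l2_add.
  ring.
Qed.

Lemma ip_split f g :
  l2 f -> K2 th g ->
  ip f g = (Cconj (ip g e / ip k e) * ip f k
            + ip f (ssub g (sscal (ip g e / ip k e)%Cx k)))%Cx.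
Proof.
  intros Hf Hg; set (c := (ip g e / ip k e)%Cx).
  assert (E : g = sadd (sscal c k) (ssub g (sscal c k)))
    by (extensionality n; unfold sadd, ssub; ring).
  rewrite E at 1.
  rewrite ip_add_r, ip_scal_r by eauto using K2_l2, l2_scal, l2_sub.
  reflexivity.
Qed.

Lemma defect_symmetric phi : ell1 phi -> bilinear_symmetric th (defect phi).
Proof.
  intros Hp f g Hf Hg; unfold defect.
  assert (HCf := K2_Cop th Hth f Hf); assert (HCg := K2_Cop th Hth g Hg).
  rewrite !ip_sub_l by eauto using K2_l2, l2_conv_ell1.
  rewrite (Hsym f g Hf Hg).
  rewrite (symbol_symmetric th (conv phi) phi Hth (ell1_l2 _ Hp) Hl1) by auto.
  reflexivity.
Qed.

Lemma defect_ker_row phi :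
  ell1 phi ->
  (forall f g, K2 th' f -> K2 th' g -> ip (defect phi f) g = C0) ->
  ((forall g, K2 th' g -> ip g k = C0) -> forall f, K2 th' f -> f = szero) ->
  exists t, forall f, K2 th' f -> ip (defect phi f) k = (t * ip f k)%Cx.
Proof.
  intros Hp H0 Hinj.
  assert (Hx : forall f g, K2 th' f -> K2 th' g ->
     (ip g k * ip (defect phi f) k)%Cx = (ip f k * ip (defect phi g) k)%Cx).
  (* Splitting [C g] leaves only its [k]-component, the rest lying in [K_th'], where the defect
     vanishes. The coefficient is computed from [<C g, e> = <C g, C k> = <k, g>]. *)
  { assert (HC : forall f g, K2 th' f -> K2 th' g ->
      ip (defect phi f) (Cop th g) = (Cconj (Cconj (ip g k) / ip k e) * ip (defect phi f) k)%Cx).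
    { intros f g Hf Hg; assert (HCg := K2_Cop th Hth g (Hsub g Hg)).
      assert (Hgl := K2_l2 th' g Hg).
      rewrite (ip_split _ (Cop th g)) by (auto using l2_defect).
      rewrite (H0 f (ssub _ _)) by (auto using K2_split).
      rewrite <- Hek at 1; rewrite ip_Cop, <- ip_conj by assumption; ring. }
    intros f g Hf Hg.
    assert (E := defect_symmetric phi Hp f g (Hsub f Hf) (Hsub g Hg)).
    rewrite !HC in E by assumption.
    assert (Hi : (Cconj (C1 / ip k e))%Cx <> C0).
    { apply Cconj_neq0; intros E0.
      assert (E1 : (C1 / ip k e * ip k e)%Cx = C1) by (field; exact Hke).
      rewrite E0 in E1.
      assert (E2 : C0 = C1) by (rewrite <- E1; ring). injection E2; lra. }
    apply (Cmul_reg_r _ _ _ Hi).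
    assert (Ed : forall x y, Cconj (Cconj x / y)%Cx = (x * Cconj (C1 / y))%Cx).
    { intros x y; unfold Cdiv; rewrite !Cconj_mul, Cconj_conj, Cconj_1; ring. }
    rewrite !Ed in E.
    transitivity (ip g k * Cconj (C1 / ip k e) * ip (defect phi f) k)%Cx; [ring |].
    rewrite E; ring. }
  (* Any [g] with [g(a)] nonzero determines [t = <D g, k> / g(a)]. If there is none, [Hinj] makes
     [K_th'] trivial, and homogeneity with scalar 0 disposes of the zero vector. *)
  destruct (excluded_middle_informative (exists g, K2 th' g /\ ip g k <> C0))
    as [[g [Hg Hg0]] | Hno].
  - exists (ip (defect phi g) k / ip g k)%Cx; intros f Hf.
    apply (Cmul_reg_r _ _ _ Hg0).
    transitivity (ip g k * ip (defect phi f) k)%Cx; [ring |].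
    rewrite (Hx f g Hf Hg); field; exact Hg0.
  - exists C0; intros f Hf.
    assert (Hv : forall g, K2 th' g -> ip g k = C0).
    { intros g Hg; destruct (excluded_middle_informative (ip g k = C0)); [assumption |].
      exfalso; apply Hno; exists g; auto. }
    assert (Ef := Hinj Hv f Hf).
    assert (E2 : f = sscal C0 f)
      by (rewrite Ef; extensionality n; unfold sscal, szero; ring).
    rewrite E2 at 1; unfold defect.
    assert (Hfl := K2_l2 th' f Hf).
    rewrite Hscal, conv_scal_r by auto using ell1_l2.
    rewrite ip_sub_l, !ip_scal_l by auto using l2_scal, l2_conv_ell1.
    ring.
Qed.

(** Symmetry moves the kernel to the other side: [<D k, g> = <D (C g), e>]. Of [C g] only the
    component [<k, g> / <k, e>] along [k] contributes, which yields the value of [s]. *)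
Lemma defect_ker_column phi :
  ell1 phi ->
  (forall f g, K2 th' f -> K2 th g -> ip (defect phi f) g = C0) ->
  exists s, forall g, K2 th g -> ip (defect phi k) g = (s * ip k g)%Cx.
Proof.
  intros Hp H0; exists (ip (defect phi k) e / ip k e)%Cx; intros g Hg.
  assert (HCg := K2_Cop th Hth g Hg).
  assert (Hgl := K2_l2 th g Hg).
  rewrite <- (Cop_Cop th Hth g) at 1 by exact Hgl.
  rewrite (defect_symmetric phi Hp k (Cop th g)) by assumption.
  rewrite Hek, ip_defect_split by assumption.
  rewrite <- Hek at 1; rewrite ip_Cop by assumption.
  assert (HKe : K2 th e) by (rewrite <- Hek; apply K2_Cop; assumption).
  rewrite (H0 (ssub _ _) e) by auto using K2_split.
  field; exact Hke.
Qed.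

(* With [D = A - phi] vanishing on the smaller space, symmetry forces
   [D f] against [k] to be [t f(a)], which the symbol [th'] reproduces, and then
   [D k] to be a multiple of [k], which the symbol [cstar th'] reproduces. *)
Lemma symbol_extend phi :
  ell1 phi ->
  (forall f g, K2 th' f -> K2 th' g -> ip (A f) g = ip (conv phi f) g) ->
  ((forall g, K2 th' g -> ip g k = C0) -> forall f, K2 th' f -> f = szero) ->
  exists psi, ell1 psi /\
    forall f g, K2 th f -> K2 th g -> ip (A f) g = ip (conv psi f) g.
Proof.
  intros Hp Hphi Hinj.
  assert (HK2l : forall f, K2 th f -> l2 f) by (intros f; apply K2_l2).
  assert (HK2l' : forall f, K2 th' f -> l2 f) by (intros f; apply K2_l2).
  assert (HK2h' : forall f, K2 th' f -> H2 f) by (intros f; apply K2_H2).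
  assert (HK2h : forall f, K2 th f -> H2 f) by (intros f; apply K2_H2).
  assert (H0 : forall f g, K2 th' f -> K2 th' g -> ip (defect phi f) g = C0).
  { intros f g Hf Hg; unfold defect; rewrite ip_sub_l, Hphi by auto using l2_conv_ell1; ring. }
  destruct (defect_ker_row phi Hp H0 Hinj) as [t Ht].
  (* The function [th' f] is orthogonal to [K_th'] and takes the value [th'(a) f(a)] at [a]; the
     coefficient therefore produces exactly [t f(a)] against [k]. *)
  set (phi1 := sscal (t / ip th' k)%Cx th').
  assert (Hp1 : ell1 phi1) by (apply ell1_sscal, Htl).
  assert (H1 : forall f g, K2 th' f -> K2 th g -> ip (defect (sadd phi phi1) f) g = C0).
  { intros f g Hf Hg.
    rewrite ip_defect_add by auto.
    rewrite (ip_split (defect phi f)), (ip_split (conv phi1 f))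
      by auto using l2_defect, l2_conv_ell1.
    set (r := ssub g _); assert (Hr : K2 th' r) by (apply K2_split, Hg).
    rewrite (H0 f r), Ht by auto; unfold phi1.
    rewrite conv_scal_l, !ip_scal_l by auto using l2_conv_ell1.
    unfold k; rewrite ip_conv_ker by auto using inner1_H2; fold k.
    rewrite (ip_conj r) by auto using l2_conv_ell1.
    destruct Hr as [_ Or]; rewrite Or by auto; rewrite Cconj_0.
    field; exact Hnz. }
  assert (Hp01 : ell1 (sadd phi phi1)) by (apply ell1_sadd; assumption).
  destruct (defect_ker_column _ Hp01 H1) as [s Hs].
  (* As [<conj(th') f, g> = <f, th' g>], this term vanishes for [f] in [K_th'], while for [f = k] it
     is [conj(th'(a)) <k, g>], which fixes the coefficient. *)
  set (phi2 := sscal (s / Cconj (ip th' k))%Cx (cstar th')).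
  assert (Hts : ell1 (cstar th')) by (apply ell1_cstar, Htl).
  assert (Hp2 : ell1 phi2) by (apply ell1_sscal, Hts).
  assert (H2' : forall f g, l2 f -> K2 th g ->
     ip (conv phi2 f) g = (s / Cconj (ip th' k) * ip f (conv th' g))%Cx).
  { intros f g Hf Hg; unfold phi2.
    rewrite conv_scal_l, ip_scal_l, ip_conv_adjoint_star
      by auto using l2_conv_ell1, ell1_l2; reflexivity. }
  exists (sadd (sadd phi phi1) phi2); split; [apply ell1_sadd; assumption |].
  intros f g Hf Hg.
  assert (E : ip (defect (sadd (sadd phi phi1) phi2) f) g = C0).
  { rewrite ip_defect_split by auto using ell1_sadd.
    set (r := ssub f _); assert (Hr : K2 th' r) by (apply K2_split, Hf).
    rewrite !(ip_defect_add (sadd phi phi1)) by auto.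
    rewrite (H1 r g), Hs, !H2' by auto.
    destruct Hr as [_ Or]; rewrite Or by auto.
    rewrite (ip_conj (conv th' g) k) by auto using l2_conv_ell1.
    unfold k; rewrite ip_conv_ker by auto using inner1_H2; fold k.
    rewrite (ip_conj g k), Cconj_mul by auto.
    field; auto using Cconj_neq0. }
  unfold defect in E; rewrite ip_sub_l in E by auto using l2_conv_ell1, ell1_sadd.
  replace (ip (A f) g) with
    ((ip (A f) g - ip (conv (sadd (sadd phi phi1) phi2) f) g)
     + ip (conv (sadd (sadd phi phi1) phi2) f) g)%Cx by ring.
  rewrite E; ring.
Qed.

End OneZeroMore.

(** * Finite Blaschke products *)

Definition bprod (zs : list Cx) : seqZ :=
  fold_right (fun a acc => conv (bfactor a) acc) delta0 zs.

Lemma blaschke_bprod gamma zs : blaschke gamma zs = sscal (Cexpi gamma) (bprod zs).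
Proof. reflexivity. Qed.

Lemma blaschke_0 zs : blaschke 0 zs = bprod zs.
Proof.
  rewrite blaschke_bprod; extensionality n; unfold sscal, Cexpi.
  rewrite cos_0, sin_0; apply Cx_ext; simpl; ring.
Qed.

Lemma Cnorm2_Cexpi g : Cnorm2 (Cexpi g) = 1.
Proof.
  unfold Cnorm2, Cexpi; simpl; pose proof (sin2_cos2 g); unfold Rsqr in *; lra.
Qed.

Lemma in_disk_cons a zs : in_disk (a :: zs) <-> Cnorm2 a < 1 /\ in_disk zs.
Proof.
  unfold in_disk; split.
  - intros H; split; [apply H; left; reflexivity | intros; apply H; right; assumption].
  - intros [H1 H2] b [<- | Hb]; auto.
Qed.

Lemma in_disk_app l m : in_disk (l ++ m) <-> in_disk l /\ in_disk m.
Proof.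
  unfold in_disk; split.
  - intros H; split; intros; apply H, in_or_app; auto.
  - intros [H1 H2] b Hb; apply in_app_or in Hb; destruct Hb; auto.
Qed.

Lemma bprod_inner1 zs : in_disk zs -> inner1 (bprod zs).
Proof.
  induction zs as [| a zs IH]; intros H; simpl; [apply inner1_delta0 |].
  apply in_disk_cons in H; destruct H; apply inner1_conv; auto using bfactor_inner1.
Qed.

Lemma blaschke_inner1 gamma zs : in_disk zs -> inner1 (blaschke gamma zs).
Proof.
  intros H; rewrite blaschke_bprod.
  apply inner1_unimodular; [apply bprod_inner1, H | apply Cnorm2_Cexpi].
Qed.

Lemma bprod_app l m :
  in_disk l -> in_disk m -> bprod (l ++ m) = conv (bprod l) (bprod m).
Proof.
  induction l as [| a l IH]; intros Hl Hm; simpl; [symmetry; apply conv_delta0_l |].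
  apply in_disk_cons in Hl; destruct Hl as [Ha Hl].
  rewrite IH, conv_assoc by
    (auto using bfactor_ell1, inner1_ell1, bprod_inner1, inner1_l2); reflexivity.
Qed.

(** Initial segments grow at the end of the list whereas [bprod] unfolds at its head; commutativity
    reconciles the two. *)
Lemma bprod_rcons l a :
  in_disk l -> Cnorm2 a < 1 -> bprod (l ++ a :: nil) = conv (bfactor a) (bprod l).
Proof.
  intros Hl Ha.
  assert (Hn : in_disk (a :: nil)) by (apply in_disk_cons; split; [exact Ha | intros ? []]).
  rewrite bprod_app by assumption.
  rewrite conv_comm by auto using bprod_inner1, inner1_l2; simpl.
  rewrite (conv_comm (bfactor a) delta0), conv_delta0_l
    by auto using ell1_l2, ell1_delta0, bfactor_ell1; reflexivity.
Qed.

Lemma ip_bprod_ker_neq0 zs a :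
  in_disk zs -> Cnorm2 a < 1 -> ~ In a zs -> ip (bprod zs) (ker a) <> C0.
Proof.
  induction zs as [| b zs IH]; intros H Ha Hin; simpl in *.
  - rewrite ip_delta0_ker; intros E; injection E; lra.
  - apply in_disk_cons in H; destruct H as [Hb H].
    assert (Hi := bprod_inner1 zs H).
    rewrite ip_conv_ker by auto using bfactor_ell1, bfactor_H2, inner1_H2.
    apply Cmul_neq0; [| apply IH; auto].
    rewrite ip_bfactor_ker by assumption.
    apply Cmul_neq0; [| apply ip_ker_ker_neq0; assumption].
    intros E; apply Hin; left.
    transitivity (a - (a - b))%Cx; [ring | rewrite E; ring].
Qed.

Lemma K2_bprod_nil f : K2 (bprod nil) f -> f = szero.
Proof.
  intros H; apply (K2_iff _ inner1_delta0) in H; destruct H as [[_ Nf] H].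
  extensionality n; destruct (Z_lt_ge_dec n 0); [apply Nf; assumption |].
  specialize (H n ltac:(lia)).
  rewrite cstar_delta0, conv_delta0_l in H; exact H.
Qed.

Lemma K2_unimodular c th f :
  inner1 th -> Cnorm2 c = 1 -> K2 (sscal c th) f <-> K2 th f.
Proof.
  intros Hth Hc.
  assert (E : forall h, H2 f -> H2 h -> ip f (conv (sscal c th) h)
                                        = (Cconj c * ip f (conv th h))%Cx).
  { intros h Hf Hh; assert (Hl := inner1_ell1 th Hth).
    rewrite conv_scal_l, ip_scal_r by auto using H2_l2, ell1_l2, l2_conv_ell1.
    reflexivity. }
  split; intros [Hf Of]; split; try exact Hf; intros h Hh; specialize (Of h Hh).
  - rewrite E in Of by assumption.
    transitivity (c * (Cconj c * ip f (conv th h)))%Cx.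
    + transitivity (c * Cconj c * ip f (conv th h))%Cx; [| ring].
      rewrite Cmul_conj, Hc; apply Cx_ext; simpl; ring.
    + rewrite Of; ring.
  - rewrite E, Of by assumption; ring.
Qed.

Lemma K2_blaschke gamma zs f :
  in_disk zs -> K2 (blaschke gamma zs) f <-> K2 (bprod zs) f.
Proof.
  intros H; apply K2_unimodular; [apply bprod_inner1, H | apply Cnorm2_Cexpi].
Qed.

(** These functions are rational with poles off the closed disk. In coefficients, each zero splits
    off a geometric kernel and leaves a factor times an element of the smaller model space. *)
Lemma K2_bprod_ell1 zs f : in_disk zs -> K2 (bprod zs) f -> ell1 f.
Proof.
  revert f; induction zs as [| a zs IH]; intros f H Hf.
  - rewrite (K2_bprod_nil f Hf); exists 0; intros N; unfold szero.
    rewrite (psumZR_ext _ (fun _ => 0)), psumZR_0 by (intros; apply Cmod_C0); lra.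
  - apply in_disk_cons in H; destruct H as [Ha H].
    assert (Hi := bprod_inner1 zs H); assert (Hb := bfactor_inner1 a Ha).
    assert (Hab := inner1_conv _ Hb _ Hi); simpl in Hf.
    assert (Hil := inner1_ell1 _ Hi); assert (Hbl := inner1_ell1 _ Hb).
    assert (Hk : K2 (conv (bfactor a) (bprod zs)) (ker a)).
    { apply K2_ker; [exact Ha | exact Hab |].
      rewrite ip_conv_ker, ip_bfactor_ker by auto using bfactor_H2, inner1_H2; ring. }
    destruct (H2_decompose a f Ha (K2_H2 _ f Hf)) as [c [Hh Ef]].
    rewrite Ef; apply ell1_sadd; [apply ell1_sscal, ker_ell1, Ha |].
    apply ell1_conv; [exact Hbl |]; apply IH; [exact H |].
    (* The quotient stays in the smaller model space because conj(th') applied to it equals conj(th)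
       applied to [f - c k], whose nonnegative coefficients vanish. *)
    apply (K2_iff _ Hi); split; [exact Hh |]; intros n Hn.
    assert (Hd := K2_sub _ Hab _ _ Hf (K2_scal _ Hab c _ Hk)).
    apply (K2_iff _ Hab) in Hd; destruct Hd as [Hd Hd0].
    rewrite conv_assoc by auto using ell1_cstar, H2_l2.
    rewrite (conv_comm (cstar _)), <- cstar_conv by auto using l2_cstar, ell1_l2.
    apply Hd0, Hn.
Qed.

Lemma K2_bprod_firstn n zs f :
  in_disk zs -> K2 (bprod (firstn n zs)) f -> K2 (bprod zs) f.
Proof.
  intros H Hf; rewrite <- (firstn_skipn n zs) in H |- *.
  apply in_disk_app in H; destruct H as [H1 H2].
  rewrite bprod_app by assumption.
  apply K2_conv; auto using inner1_ell1, inner1_H2, bprod_inner1.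
Qed.

Lemma K2_divides al th f :
  inner1 al -> inner1 th -> divides al th -> K2 al f -> K2 th f.
Proof.
  intros Hal Hth [_ [_ [Hw _]]] Hf.
  rewrite <- (inner1_cancel al Hal th) by (apply inner1_l2, Hth).
  apply K2_conv; auto using inner1_ell1, ell1_conv, inner1_star_ell1.
Qed.

Lemma inner1_is_inner th : inner1 th -> is_inner th.
Proof. intros [_ H]; exact H. Qed.

Lemma divides_blaschke_firstn gamma zs n :
  in_disk zs -> divides (blaschke 0 (firstn n zs)) (blaschke gamma zs).
Proof.
  intros H; rewrite blaschke_0.
  assert (H' := H); rewrite <- (firstn_skipn n zs) in H'.
  apply in_disk_app in H'; destruct H' as [H1 H2].
  assert (Hi1 := bprod_inner1 _ H1); assert (Hi2 := bprod_inner1 _ H2).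
  split; [| split]; try (apply inner1_is_inner; auto using blaschke_inner1).
  rewrite blaschke_bprod.
  rewrite <- (firstn_skipn n zs) at 2; rewrite bprod_app by assumption.
  rewrite conv_scal_r, inner1_cancel_star
    by auto using inner1_l2, l2_conv_ell1, inner1_ell1, l2_cstar.
  apply inner1_unimodular; [exact Hi2 | apply Cnorm2_Cexpi].
Qed.

(** With at least one zero [b], the kernel at [b] lies in the space and does not vanish at [a]; so
    the hypothesis leaves only the empty product. *)
Lemma K2_bprod_vanish zs a f :
  in_disk zs -> Cnorm2 a < 1 ->
  (forall g, K2 (bprod zs) g -> ip g (ker a) = C0) -> K2 (bprod zs) f -> f = szero.
Proof.
  intros H Ha Hv Hf; destruct zs as [| b zs]; [apply K2_bprod_nil, Hf |].
  exfalso; assert (Hi := bprod_inner1 _ H).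
  apply in_disk_cons in H; destruct H as [Hb H]; assert (Hzi := bprod_inner1 _ H).
  apply (ip_ker_ker_neq0 a b Ha Hb), Hv, K2_ker; [exact Hb | exact Hi |]; simpl.
  rewrite ip_conv_ker, ip_bfactor_ker
    by auto using bfactor_ell1, bfactor_H2, inner1_H2; ring.
Qed.

(** * From symbols to the equivalence *)

(** A summable symbol acts on the whole space, so [f] approximates itself in the density clause, and
    Young's inequality followed by the contraction [Pth] gives the bound [M * M]. *)
Lemma symbol_in_TTO th A phi :
  inner1 th -> ell1 phi -> (forall f, K2 th f -> K2 th (A f)) ->
  (forall f g, K2 th f -> K2 th g -> ip (A f) g = ip (conv phi f) g) -> in_TTO th A.
Proof.
  intros Hth Hp HA H; exists phi; split; [apply ell1_l2, Hp |]; split; [| split].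
  - intros f Hf eps He; exists f; split; [exact Hf |]; split.
    + apply l2_conv_ell1; [exact Hp | apply (K2_l2 th), Hf].
    + replace (ssub f f) with szero by (extensionality n; unfold ssub, szero; ring).
      eapply Rle_lt_trans; [apply (nsq_le _ 0) | exact He]; [apply l2_zero |].
      intros N; rewrite (psumZR_ext _ (fun _ => 0)), psumZR_0; [lra |].
      intros; unfold Cnorm2; simpl; ring.
  - destruct (ell1_bound_pos phi Hp) as [M [HM0 HM]].
    exists (M * M)%R; intros f Hf Hl.
    eapply Rle_trans; [apply (nsq_Pth_le th Hth), Hl |].
    apply nsq_le; [exact Hl |].
    apply conv_ell1_energy; [exact HM0 | exact HM |].
    apply nsq_energy, (K2_l2 th), Hf.
  - intros f Hf Hl; symmetry; apply Pth_unique; auto.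
Qed.

(** Summability of [f] makes [conv phi f] square summable on all of [K_th], so the defining equation
    for [A] holds everywhere and no density argument is involved. Against test functions from the
    smaller space the projection onto [K_th] drops out. *)
Lemma TTO_bilinear_symmetric th al A :
  inner1 al -> inner1 th ->
  (forall f, K2 al f -> K2 th f) -> (forall f, K2 th f -> ell1 f) ->
  in_TTO th A -> bilinear_symmetric al A.
Proof.
  intros Hal Hth Hsub Hl1 [phi [Hp [_ [_ HA]]]].
  apply (symbol_symmetric al A phi); auto.
  intros f g Hf Hg.
  assert (Hl : l2 (conv phi f)).
  { assert (Hf1 := Hl1 f (Hsub f Hf)).
    rewrite conv_comm by auto using ell1_l2; apply l2_conv_ell1; assumption. }
  rewrite HA by auto; apply Pth_spec; auto.
Qed.

(** The same [A] is tested on the increasing chain of spaces given by initial segments. Each stage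
    uses the previous symbol and the symmetry condition for the longer segment only. *)
Lemma bilinear_symmetric_symbol zs A :
  in_disk zs -> NoDup zs -> lin_op_on (bprod zs) A ->
  (forall n, (1 <= n <= length zs)%nat -> bilinear_symmetric (bprod (firstn n zs)) A) ->
  exists phi, ell1 phi /\
    forall f g, K2 (bprod zs) f -> K2 (bprod zs) g -> ip (A f) g = ip (conv phi f) g.
Proof.
  intros H Hnd [HA [Hadd Hscal]] Hsym.
  assert (Hind : forall n, (n <= length zs)%nat ->
    exists phi, ell1 phi /\ forall f g,
      K2 (bprod (firstn n zs)) f -> K2 (bprod (firstn n zs)) g ->
      ip (A f) g = ip (conv phi f) g).
  { induction n as [| n IH]; intros Hn.
    (* The empty product has a trivial model space, so any summable symbol would serve. *)
    - exists delta0; split; [apply ell1_delta0 |]; intros f g Hf Hg.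
      rewrite (K2_bprod_nil g Hg), !ip_zero by (right; reflexivity); reflexivity.
    - destruct (IH ltac:(lia)) as [phi [Hp Hphi]].
      destruct (nth_split zs C0 (n := n)) as [l1 [l2 [Ezs El]]]; [lia |].
      set (a := nth n zs C0) in *; clearbody a.
      assert (E1 : firstn n zs = l1).
      { rewrite Ezs, <- El, firstn_app, Nat.sub_diag, firstn_all, app_nil_r; reflexivity. }
      assert (E2 : firstn (S n) zs = l1 ++ a :: nil).
      { rewrite Ezs, <- El, firstn_app, firstn_all2 by lia.
        replace (S (length l1) - length l1)%nat with 1%nat by lia; reflexivity. }
      assert (Hd := H); rewrite Ezs in Hd; apply in_disk_app in Hd.
      destruct Hd as [Hd1 Hd2]; apply in_disk_cons in Hd2; destruct Hd2 as [Ha _].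
      assert (Hna : ~ In a l1).
      { rewrite Ezs in Hnd; apply NoDup_remove_2 in Hnd.
        intros Hi; apply Hnd, in_or_app; auto. }
      assert (Hs := Hsym (S n) ltac:(lia)).
      assert (Hsub : forall f, K2 (bprod (firstn (S n) zs)) f -> K2 (bprod zs) f)
        by (intros; eapply K2_bprod_firstn; eassumption).
      rewrite E2, bprod_rcons in * by assumption; rewrite E1 in Hphi.
      apply (symbol_extend (bprod l1) a A) with (phi := phi);
        auto using bprod_inner1, ip_bprod_ker_neq0.
      + intros f Hf; apply (K2_bprod_ell1 zs); auto.
      + intros f Hf; apply (K2_l2 (bprod zs)); auto.
      + intros Hv f Hf; apply (K2_bprod_vanish l1 a); assumption. }
  destruct (Hind (length zs) ltac:(lia)) as [phi Hphi].
  rewrite firstn_all in Hphi; exists phi; exact Hphi.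
Qed.

Theorem theorem4p3 (gamma : R) (zs : list Cx) (A : seqZ -> seqZ) :
  in_disk zs -> NoDup zs ->
  lin_op_on (blaschke gamma zs) A ->
  (in_TTO (blaschke gamma zs) A <->
     (forall (gs : R) (zsg : list Cx),
        zsg <> nil -> in_disk zsg ->
        divides (blaschke gs zsg) (blaschke gamma zs) ->
        Csymmetric (blaschke gs zsg) (compress (blaschke gs zsg) A))) /\
  (in_TTO (blaschke gamma zs) A <->
     (forall n : nat, (1 <= n <= length zs)%nat ->
        Csymmetric (blaschke 0 (firstn n zs))
                   (compress (blaschke 0 (firstn n zs)) A))).
Proof.
  intros H Hnd HA.
  assert (Hi := blaschke_inner1 gamma zs H).
  assert (HK : forall f, K2 (blaschke gamma zs) f <-> K2 (bprod zs) f)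
    by (intros; apply K2_blaschke, H).
  assert (HKl : forall f, K2 (blaschke gamma zs) f -> l2 (A f))
    by (intros f Hf; apply (K2_l2 (blaschke gamma zs)), HA, Hf).
  assert (Hfd : forall n, in_disk (firstn n zs)).
  { intros n; assert (H' := H); rewrite <- (firstn_skipn n zs) in H'.
    apply in_disk_app in H'; apply H'. }
  assert (H12 : in_TTO (blaschke gamma zs) A ->
    forall (gs : R) (zsg : list Cx), zsg <> nil -> in_disk zsg ->
      divides (blaschke gs zsg) (blaschke gamma zs) ->
      Csymmetric (blaschke gs zsg) (compress (blaschke gs zsg) A)).
  { intros HT gs zsg _ Hg Hdiv; assert (Hgi := blaschke_inner1 gs zsg Hg).
    assert (Hsub : forall f, K2 (blaschke gs zsg) f -> K2 (blaschke gamma zs) f)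
      by (intros f; apply K2_divides; assumption).
    apply Csymmetric_compress; auto.
    apply (TTO_bilinear_symmetric (blaschke gamma zs)); auto.
    intros f Hf; apply (K2_bprod_ell1 zs), HK; assumption. }
  assert (H23 : (forall (gs : R) (zsg : list Cx), zsg <> nil -> in_disk zsg ->
      divides (blaschke gs zsg) (blaschke gamma zs) ->
      Csymmetric (blaschke gs zsg) (compress (blaschke gs zsg) A)) ->
    forall n : nat, (1 <= n <= length zs)%nat ->
      Csymmetric (blaschke 0 (firstn n zs)) (compress (blaschke 0 (firstn n zs)) A)).
  (* Initial segments are particular divisors, and [n >= 1] makes them nonconstant. *)
  { intros H2 n Hn; apply H2; auto using divides_blaschke_firstn.
    intros E; apply (f_equal (@length Cx)) in E; rewrite length_firstn in E.
    simpl in E; lia. }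
  assert (H31 : (forall n : nat, (1 <= n <= length zs)%nat ->
      Csymmetric (blaschke 0 (firstn n zs)) (compress (blaschke 0 (firstn n zs)) A)) ->
    in_TTO (blaschke gamma zs) A).
  { intros H3.
    destruct (bilinear_symmetric_symbol zs A H Hnd) as [phi [Hp Hphi]].
    (* The unimodular constant does not change the model space, so linearity transfers to
       [bprod zs]. *)
    - destruct HA as [HA1 [HA2 HA3]]; split; [| split]; intros.
      + apply HK, HA1, HK; assumption.
      + apply HA2; apply HK; assumption.
      + apply HA3; apply HK; assumption.
    - intros n Hn; specialize (H3 n Hn); rewrite blaschke_0 in H3.
      apply Csymmetric_compress in H3; auto using bprod_inner1.
      intros f Hf; apply HKl, HK, (K2_bprod_firstn n); assumption.
    - apply (symbol_in_TTO _ A phi); auto.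
      + apply HA.
      + intros f g Hf Hg; apply Hphi; apply HK; assumption. }
  split; split; auto.
Qed.
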